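(* For every finite simple undirected planar graph $G$ it holds that $\chi_o(G)\leq 9$. That is, every finite simple planar graph $G$ admits a proper vertex coloring $\varphi: V(G)\to\{1,\ldots,9\}$ such that for every non-isolated vertex $x\in V(G)$ there exists a color $c$ for which $|\varphi^{-1}(c)\cap N_G(x)|$ is odd.
   Context: All graphs are simple, finite and undirected. For a vertex $x$ of a graph $G$, $N_G(x)$ denotes the open neighborhood of $x$, i.e. the set of vertices adjacent to $x$. A $k$-coloring of $G$ is a map $\varphi: V(G)\to\{1,\ldots,k\}$ (not necessarily surjective); it is proper if every color class $\varphi^{-1}(c)$ is an independent set. A coloring $\varphi$ is odd (with respect to neighborhoods) if for every non-isolated vertex $x$ there is a color $c$ such that $|\varphi^{-1}(c)\cap N_G(x)|$ is odd. The odd chromatic number $\chi_o(G)$ is the minimum number of colors in any proper coloring of $G$ that is odd with respect to neighborhoods. *)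

(* Defs.v *)
From HB Require Import structures.
From mathcomp Require Import all_boot all_order all_algebra.
From mathcomp Require Import all_classical all_reals all_analysis.

Set Implicit Arguments.
Unset Strict Implicit.
Unset Printing Implicit Defensive.

Import Order.TTheory GRing.Theory Num.Theory.
Import numFieldNormedType.Exports.

Record sgraph := SGraph {
  vertex :> finType;
  adj : rel vertex;
  adj_sym : symmetric adj;
  adj_irrefl : irreflexive adj
}.

Section Colorings.
Variable G : sgraph.

Definition nbhd (x : G) : {set G} := [set y | adj x y]%SET.

Definition proper_coloring (k : nat) (phi : {ffun G -> 'I_k}) : bool :=
  [forall x : G, forall y : G, adj x y ==> (phi x != phi y)].

Definition odd_coloring (k : nat) (phi : {ffun G -> 'I_k}) : bool :=
  [forall x : G, (nbhd x != finset.set0) ==>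
     [exists c : 'I_k, odd #|[set y in nbhd x | phi y == c]%SET|]].

Definition odd_colorable (k : nat) : bool :=
  [exists phi : {ffun G -> 'I_k}, proper_coloring phi && odd_coloring phi].

Lemma odd_colorable_exists : exists k, odd_colorable k.
Proof.
exists #|G|; apply/existsP; exists [ffun x => enum_rank x].
apply/andP; split.
  apply/forallP => x; apply/forallP => y; apply/implyP => xy.
  rewrite !ffunE (inj_eq enum_rank_inj).
  by apply: contraTneq xy => ->; rewrite adj_irrefl.
apply/forallP => x; apply/implyP => /finset.set0Pn[y xy].
apply/existsP; exists (enum_rank y).
suff -> : [set z in nbhd x | [ffun x => enum_rank x] z == enum_rank y]%SET
          = [set y]%SET by rewrite cards1.
apply/setP => z; rewrite !finset.inE ffunE (inj_eq enum_rank_inj).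
by case: eqVneq => [->|]; rewrite ?andbF ?andbT //; rewrite finset.inE in xy.
Qed.

Definition odd_chromatic_number : nat := ex_minn odd_colorable_exists.

End Colorings.

Section Planarity.
Local Open Scope classical_set_scope.
Local Open Scope ring_scope.
Variable R : realType.

Definition plane := (R * R)%type.

(* A is a simple (non self-crossing) arc of the plane from a to b. *)
Definition simple_arc (a b : plane) (A : set plane) : Prop :=
  exists g : R -> plane,
    [/\ {within `[0, 1], continuous g}, set_inj `[0, 1] g,
        g 0 = a, g 1 = b & A = g @` `[0, 1]].

(* pos places the vertices and arc (finset of the two ends) is the closed point
   set drawn for an edge; the values of arc on other sets are irrelevant. *)
Definition plane_drawing (G : sgraph) (pos : G -> plane)
    (arc : {set G} -> set plane) : Prop :=
  [/\ injective pos,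
      forall u v : G, adj u v ->
        simple_arc (pos u) (pos v) (arc [set u; v]%SET),
      forall u v w : G, adj u v ->
        arc [set u; v]%SET (pos w) -> w \in [set u; v]%SET
    & forall u v u' v' : G, adj u v -> adj u' v' ->
        [set u; v]%SET != [set u'; v']%SET ->
        forall p : plane, arc [set u; v]%SET p -> arc [set u'; v']%SET p ->
        exists w : G, w \in ([set u; v] :&: [set u'; v'])%SET /\ p = pos w].

Definition planar (G : sgraph) : Prop :=
  exists (pos : G -> plane) (arc : {set G} -> set plane), plane_drawing pos arc.

End Planarity.

(* Main.v *)
(* A topological drawing is first discretized: on a fine grid, every vertex becomes
   the block of grid points near it and every arc a thin tube of grid points, so a
   planar graph is a minor of a grid.  For a minor of a grid the unit squares, with
   those separated by a deleted grid edge identified, are faces: by counting the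
   crossings of a horizontal ray with an even subgraph one sees that the face
   boundaries span the cycle space over F_2, and each edge lies in at most two of them.
   Comparing dimensions gives Euler's inequality without any use of the Jordan curve
   theorem.

   A minimal counterexample has no vertex of degree at most 4 (contract an edge there:
   the contracted neighbor then has a unique color in the neighborhood), no 5-vertex
   with two odd neighbors, no two adjacent 5-vertices with two common neighbors, and
   no triangle of degrees 5, 6, 6 whose two edges at the 5-vertex lie in further,
   distinct triangles.  In the last cases the clique is deleted, the rest is colored by
   minimality, and colors for the clique are chosen from lists.

   Discharging: vertices get d - 6, faces 2 l - 6, and an edge in c faces 4 - 2 c, with
   a negative total.  A 5-vertex receives 1 from an incident face of length at least
   4 or edge with c < 2.  Otherwise it has at least two neighbors of degree at least 8,
   each of which can afford to send it 1/2. *)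
From mathcomp Require Import all_boot all_order all_algebra.
From mathcomp Require Import boolp zify ring lra.

Set Implicit Arguments.
Unset Strict Implicit.
Unset Printing Implicit Defensive.

(** * Extending odd colorings across a deleted clique *)

(** A vertex to be colored must avoid the color of each remaining neighbor and, so as not to spoil
    that neighbor, one of the odd colors that it sees: two colors per neighbor, so degree 4 loses
    eight and leaves a ninth. Larger degrees need savings. A neighborhood of odd size always has an
    odd color, so odd neighbors cost one. A common neighbor of several members of a deleted clique
    also costs each of them one, at the price of a single forbidden set: the new colors it sees,
    distinct because of the clique, must not form exactly the set of odd colors it already has.
    Faces are understood modulo 2. A boundary is an even subgraph, not a closed walk: a bridge lies
    on no boundary, and the two sides of a cycle have the same one. Hence edges carry charge too,
    and around a 5-vertex whose edges all lie on two triangles, these triangles take over the part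
    of a rotation system. *)

Definition nb (T : finType) (e : rel T) (x : T) : {set T} := [set y | e x y].

Section OddColors.
Variables (T C : finType).
Implicit Types (phi k : T -> C) (N S : {set T}).

Definition odd_colors phi N : {set C} :=
  [set c | odd #|[set y in N | phi y == c]|].

Lemma eq_in_odd_colors phi k N : {in N, phi =1 k} -> odd_colors phi N = odd_colors k N.
Proof.
move=> eq_phi; apply/setP=> c; rewrite !inE; congr (odd _); apply: eq_card => y.
by rewrite !inE; case: (boolP (y \in N)) => // /eq_phi ->.
Qed.

Lemma in_odd_colorsU phi N S c : [disjoint N & S] ->
  (c \in odd_colors phi (N :|: S)) = (c \in odd_colors phi N) (+) (c \in odd_colors phi S).
Proof.
move=> dis; rewrite !inE.
have -> : [set y in N :|: S | phi y == c] =
          [set y in N | phi y == c] :|: [set y in S | phi y == c].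
  by apply/setP=> y; rewrite !inE andb_orl.
rewrite cardsU (_ : _ :&: _ = set0) ?cards0 ?subn0 ?oddD //.
apply/setP=> y; rewrite !inE; case: (boolP (y \in N)) => //= yN.
by rewrite (disjointFr dis yN) andbF.
Qed.

Lemma odd_colors_inj phi N : {in N &, injective phi} -> odd_colors phi N = phi @: N.
Proof.
move=> inj; apply/setP=> c; rewrite inE; apply/idP/imsetP => [oddc | [y yN ->]].
  have /card_gt0P[y] : 0 < #|[set y in N | phi y == c]| by rewrite odd_gt0.
  by rewrite inE => /andP[yN /eqP <-]; exists y.
rewrite (_ : [set _ in _ | _] = [set y]) ?cards1 //.
apply/setP=> z; rewrite !inE; apply/andP/eqP => [[zN /eqP/inj]|->]; last by [].
exact.
Qed.

(** Modulo 2 a color class counts 1 exactly when its color is odd. In particular a neighborhood of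
    odd size has an odd color under every coloring. *)
Lemma odd_card_odd_colors phi N : odd #|odd_colors phi N| = odd #|N|.
Proof.
have -> : #|N| = \sum_c #|[set y in N | phi y == c]|.
  rewrite -sum1_card (partition_big phi predT) //=; apply: eq_bigr => c _.
  by rewrite -sum1_card; apply: eq_bigl => y; rewrite inE.
rewrite -sum1_card big_mkcond /=.
apply: (big_ind2 (fun a b => odd a = odd b)) => // [a b c d|c _]; first by rewrite !oddD => -> ->.
by rewrite inE; case: ifP.
Qed.
End OddColors.

Section Extension.
Variables (T C : finType) (e : rel T).
Hypotheses (e_sym : symmetric e) (e_irr : irreflexive e).
Implicit Types (phi k : T -> C) (S X : {set T}).

Definition odd_good (e' : rel T) phi :=
  (forall x y, e' x y -> phi x != phi y) /\
  (forall x, nb e' x != set0 -> odd_colors phi (nb e' x) != set0).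

(* Odd colors seen by [x] when the vertices of the deleted clique [S] are uncolored. *)
Definition outer phi S x := odd_colors phi (nb e x :\: S).

(* If the colors [k @: (nb e x :&: S)] given to the clique differ from the set of
   odd colors already seen by [x], the symmetric difference survives. *)
Lemma odd_extension phi k S :
  {in S &, injective k} ->
  (forall x y, x \notin S -> y \notin S -> e x y -> phi x != phi y) ->
  (forall s y, s \in S -> y \notin S -> e s y -> k s != phi y) ->
  (forall x, x \notin S -> nb e x :&: S = set0 -> nb e x != set0 ->
     outer phi S x != set0) ->
  (forall x, nb e x != set0 -> (x \in S) || (nb e x :&: S != set0) ->
     k @: (nb e x :&: S) != outer phi S x) ->
  odd_good e (fun x => if x \in S then k x else phi x).
Proof.
move=> k_inj phi_proper k_proper phi_odd k_odd; split=> [x y exy|x x_nb].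
  have [xS|xS] := boolP (x \in S); have [yS|yS] := boolP (y \in S).
  - by apply: contraTneq exy => /k_inj -> //; rewrite e_irr.
  - exact: k_proper.
  - by rewrite eq_sym; apply: k_proper; rewrite // e_sym.
  - exact: phi_proper.
set psi := fun x => _.
have psiE c : (c \in odd_colors psi (nb e x)) =
    (c \in k @: (nb e x :&: S)) (+) (c \in outer phi S x).
  rewrite -{1}(setID (nb e x) S) in_odd_colorsU; last first.
    by rewrite disjoints_subset; apply/subsetP=> y; rewrite !inE => /andP[_ ->].
  congr addb.
    rewrite (eq_in_odd_colors (k := k)); last by move=> y; rewrite !inE /psi => /andP[_ ->].
    rewrite odd_colors_inj // => y z; rewrite !inE => /andP[_ yS] /andP[_ zS].
    exact: k_inj.
  by rewrite (eq_in_odd_colors (k := phi)) // => y; rewrite !inE /psi => /andP[/negPf ->].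
have : k @: (nb e x :&: S) != outer phi S x.
  have [xNS|] := boolP ((x \in S) || (nb e x :&: S != set0)); first exact: k_odd.
  rewrite negb_or negbK => /andP[xS /eqP xNS]; rewrite xNS imset0 eq_sym.
  exact: phi_odd.
apply: contra_neq => psi0; apply/setP=> c.
by have := psiE c; rewrite psi0 inE; case: (c \in _); case: (c \in _).
Qed.

(** Equality would make the numbers of neighbors inside and outside [S] agree modulo 2, because [k]
    is injective on [S], and the degree would be even. *)
Lemma odd_degree_extension phi k S x :
  {in S &, injective k} -> odd #|nb e x| -> k @: (nb e x :&: S) != outer phi S x.
Proof.
move=> k_inj; apply: contraTneq => /(congr1 (fun A : {set C} => odd #|A|)).
rewrite odd_card_odd_colors card_in_imset; last first.
  by move=> y z; rewrite !inE => /andP[_ yS] /andP[_ zS]; apply: k_inj.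
by rewrite -(cardsID S (nb e x)) oddD => ->; case: odd.
Qed.

(* Avoiding one chosen odd color of [x] on the clique keeps that color odd at [x]. *)
Definition chosen phi S x : {set C} :=
  if [pick c in outer phi S x] is Some c then [set c] else set0.

Lemma card_chosen phi S x : #|chosen phi S x| <= 1.
Proof. by rewrite /chosen; case: pickP => [c _|_]; rewrite ?cards1 ?cards0. Qed.

Lemma chosen_extension phi k S x : nb e x :&: S != set0 ->
  (forall s, s \in nb e x :&: S -> k s \notin chosen phi S x) ->
  k @: (nb e x :&: S) != outer phi S x.
Proof.
case/set0Pn=> s sx; rewrite /chosen; case: pickP => [c cO kF|O0 _].
  apply: contraTneq cO => <-; apply/imsetP=> -[t tx ct].
  by have := kF t tx; rewrite inE ct eqxx.
by apply/eqP=> eqO; have := O0 (k s); rewrite -eqO imset_f.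
Qed.

(** [X] holds the vertices whose oddness is secured by other means (odd degree, or an explicit
    condition on the colors of the clique), so each of them costs one color instead of two. *)
Definition forbidden phi S X s : {set C} :=
  \bigcup_(y in nb e s :\: S) (phi y |: (if y \in X then set0 else chosen phi S y)).

Lemma card_forbidden phi S X s :
  #|forbidden phi S X s| + #|X :&: (nb e s :\: S)| <= 2 * #|nb e s :\: S|.
Proof.
have le_sum : #|forbidden phi S X s| <= \sum_(y in nb e s :\: S) (1 + (y \notin X)).
  rewrite /forbidden; elim/big_ind2: _ => [|A m B n Am Bn|y _].
  - by rewrite cards0.
  - by rewrite (leq_trans _ (leq_add Am Bn)) // cardsU leq_subr.
  rewrite (leq_trans (leq_card_setU _ _)) // cards1 leq_add2l.
  by case: ifP; rewrite ?cards0 ?card_chosen.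
apply: leq_trans (leq_add le_sum (leqnn _)) _.
have -> : #|X :&: (nb e s :\: S)| = \sum_(y in nb e s :\: S) (y \in X).
  rewrite -sum1_card big_mkcond [RHS]big_mkcond /=; apply: eq_bigr => y _.
  by rewrite in_setI; do 2!case: (y \in _).
by rewrite -big_split /= mulnC -sum_nat_const leq_sum // => y _; case: (y \in X).
Qed.

Lemma forbidden_proper phi S X s y c :
  y \notin S -> e s y -> c \notin forbidden phi S X s -> c != phi y.
Proof.
move=> yS esy; apply: contraNneq => ->; apply/bigcupP; exists y; last by rewrite !inE eqxx.
by rewrite !inE yS esy.
Qed.

Lemma forbidden_chosen phi S X s y c :
  y \notin S -> y \notin X -> e s y -> c \notin forbidden phi S X s ->
  c \notin chosen phi S y.
Proof.
move=> yS /negPf yX esy; apply: contra => cF; apply/bigcupP; exists y.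
  by rewrite !inE yS esy.
by rewrite yX !inE cF orbT.
Qed.

End Extension.

Definition colorable (T : finType) (e : rel T) := exists phi : T -> 'I_9, odd_good e phi.

(** Deleted and contracted vertices stay in the type as isolated vertices, on which [odd_good]
    imposes nothing; size is therefore measured by the number of non-isolated vertices. *)
Definition delete (T : finType) (e : rel T) (S : {set T}) : rel T :=
  fun x y => [&& x \notin S, y \notin S & e x y].

Definition contract (T : finType) (e : rel T) (v w : T) : rel T :=
  fun x y => [&& x != v, y != v, x != y &
    [|| e x y, (x == w) && e v y | (y == w) && e v x]].

Section Reductions.
Variables (T : finType) (e : rel T).
Hypotheses (e_sym : symmetric e) (e_irr : irreflexive e).
Implicit Types (phi : T -> 'I_9) (X S : {set T}).

Lemma exists_notin (A : {set 'I_9}) : #|A| < 9 -> exists c, c \notin A.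
Proof.
move=> ltA; have : #|~: A| > 0 by rewrite cardsCs card_ord setCK subn_gt0.
by case/card_gt0P=> c; rewrite inE; exists c.
Qed.

Lemma deleted_good_proper S phi : odd_good (delete e S) phi ->
  forall x y, x \notin S -> y \notin S -> e x y -> phi x != phi y.
Proof. by case=> prop _ x y xS yS exy; apply: prop; rewrite /delete xS yS. Qed.

Lemma deleted_good_odd S phi : odd_good (delete e S) phi ->
  forall x, x \notin S -> nb e x :&: S = set0 -> nb e x != set0 -> outer e phi S x != set0.
Proof.
case=> _ odd_phi x xS xNS xnb; have nbE : nb (delete e S) x = nb e x :\: S.
  by apply/setP=> y; rewrite !inE /delete xS.
rewrite /outer -nbE; apply: odd_phi; rewrite nbE; apply: contra_neq xnb => D0.
by rewrite -(setID (nb e x) S) xNS D0 setU0.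
Qed.

(** Stated for a coloring that is good away from [v], so that it serves both a contraction and a
    deletion at [v]; the value [phi v] is overwritten. Each neighbor forbids two colors, each
    neighbor in [X] only one. *)
Lemma reduce_vertex v phi X :
  (forall x y, x != v -> y != v -> e x y -> phi x != phi y) ->
  (forall x, x != v -> ~~ e x v -> nb e x != set0 -> odd_colors phi (nb e x) != set0) ->
  (nb e v != set0 -> odd_colors phi (nb e v) != set0) ->
  (forall x, x \in X -> odd #|nb e x|) ->
  2 * #|nb e v| < 9 + #|X :&: nb e v| -> colorable e.
Proof.
move=> prop odd_phi odd_v Xodd ltd.
have nbD x : ~~ e x v -> nb e x :\: [set v] = nb e x.
  move=> xv; apply/setDidPl; rewrite disjoint_sym disjoints1 inE xv //.
have ltF : #|forbidden e phi [set v] X v| < 9.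
  have := card_forbidden e phi [set v] X v; rewrite nbD ?e_irr // => le1.
  by rewrite -(ltn_add2r #|X :&: nb e v|); apply: leq_ltn_trans ltd.
have [c cF] := exists_notin ltF.
exists (fun x => if x \in [set v] then c else phi x).
apply: odd_extension => // [s t|x y|s y|x|x xnb].
- by rewrite !inE => /eqP -> /eqP ->.
- by rewrite !inE; apply: prop.
- by rewrite inE => /eqP -> yv evy; apply: forbidden_proper evy cF.
- rewrite inE => xv xNS xnb; have xv' : ~~ e x v.
    by apply/negP => xv'; move/setP/(_ v): xNS; rewrite !inE xv' eqxx.
  by rewrite /outer nbD // odd_phi.
rewrite inE; move: xnb; case: (x =P v) => [->|/eqP xv] xnb /= xS.
  rewrite (_ : _ :&: _ = set0) ?imset0 1?eq_sym; last first.
    by apply/setP=> y; rewrite !inE; case: eqP => [->|]; rewrite ?e_irr ?andbF.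
  by rewrite /outer nbD ?e_irr ?odd_v.
have evx : e v x.
  by case/set0Pn: xS => y; rewrite !inE => /andP[xy /eqP <-]; rewrite e_sym.
have [xX|xX] := boolP (x \in X).
  by apply: odd_degree_extension; [move=> s t; rewrite !inE => /eqP -> /eqP ->|exact: Xodd].
apply: chosen_extension => // s _.
by apply: forbidden_chosen cF => //; rewrite inE.
Qed.

Lemma reduce_contract v w : e v w -> #|nb e v| <= 4 -> colorable (contract e v w) -> colorable e.
Proof.
move=> evw dv [phi [prop odd_phi]]; apply: (@reduce_vertex v phi set0).
- move=> x y xv yv exy; apply: prop; rewrite /contract xv yv exy andbT /=.
  by apply: contraTneq exy => ->; rewrite e_irr.
- move=> x xv nxv; suff -> : nb e x = nb (contract e v w) x by apply: odd_phi.
  have xw : x != w by apply: contraNneq nxv => ->; rewrite e_sym.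
  apply/setP=> y; rewrite !inE /contract xv (negPf xw) (e_sym v x) (negPf nxv) andbF !orbF.
  case: (y =P v) => [->|_]; first by rewrite (negPf nxv).
  by case: eqP => // <-; rewrite e_irr.
- move=> _; apply/set0Pn; exists (phi w); rewrite inE.
  rewrite (_ : [set _ in _ | _] = [set w]) ?cards1 //.
  apply/setP=> y; rewrite !inE; apply/andP/eqP => [[evy /eqP eqphi]|->]; last by [].
  apply/eqP; apply: contraTT (eqxx (phi w)) => yw; rewrite -{1}eqphi.
  apply: prop; rewrite /contract yw eqxx evy !orbT !andbT.
  by apply/andP; split; [apply: contraTneq evy|apply: contraTneq evw] => ->; rewrite e_irr.
- by move=> x; rewrite inE.
by rewrite set0I cards0 addn0 (@leq_ltn_trans 8) // (leq_mul2l 2 _ 4).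
Qed.

(** Odd neighbors are safe by parity, as is [v] itself, which leaves at most [2 * 5 - 2 = 8]
    forbidden colors. *)
Lemma reduce_five_odd v : #|nb e v| = 5 ->
  1 < #|[set x in nb e v | odd #|nb e x|]| -> colorable (delete e [set v]) -> colorable e.
Proof.
move=> dv lt1 [phi good_phi].
apply: (@reduce_vertex v phi [set x | odd #|nb e x|]).
- by move=> x y xv yv; apply: (deleted_good_proper good_phi); rewrite inE.
- move=> x xv nxv xnb; have := deleted_good_odd good_phi (x := x).
  rewrite /outer !inE (_ : nb e x :\: [set v] = nb e x); last first.
    by apply/setDidPl; rewrite disjoint_sym disjoints1 inE.
  apply=> //; apply/setP=> y; rewrite !inE; case: (y =P v) => [->|]; last by rewrite andbF.
  by rewrite (negPf nxv).
- move=> _; apply: contraTneq isT => odd0.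
  by have := odd_card_odd_colors phi (nb e v); rewrite odd0 dv cards0.
- by move=> x; rewrite inE.
rewrite dv (_ : _ :&: _ = [set x in nb e v | odd #|nb e x|]).
  by rewrite (@leq_trans (9 + 2)) // leq_add2l.
by apply/setP=> x; rewrite !inE andbC.
Qed.

End Reductions.

(** * List coloring a triangle *)

Section ColorLists.
Variable C : finType.
Implicit Types (A B D E F O X P Q R : {set C}) (a b c d x : C).

(** Here [E] is the set of odd colors a vertex already sees and [X] the new colors fixed so far
    around it: the last clique color must not complete [X] to [E]. *)
Definition completion E X := if (X \subset E) && (#|E| == #|X|.+1) then E :\: X else set0.

Lemma card_completion E X : #|completion E X| <= 1.
Proof.
rewrite /completion; case: andP => [[sXE /eqP cE]|_]; last by rewrite cards0.
by rewrite cardsD (setIidPr sXE) cE subSnn.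
Qed.

Lemma completion_neq0 E X : 0 < #|completion E X| -> X \subset E /\ #|E| = #|X|.+1.
Proof. by rewrite /completion; case: andP => [[? /eqP]|]; rewrite ?cards0. Qed.

Lemma mem_completion E X x : x \notin X -> x |: X = E -> x \in completion E X.
Proof. by move=> xX <-; rewrite /completion subsetUr cardsU1 xX eqxx !inE eqxx xX. Qed.

Lemma completionE E X x :
  0 < #|completion E X| -> x \in E -> x \notin X -> completion E X = [set x].
Proof.
move=> E0 xE xX; apply/eqP; rewrite eq_sym eqEcard cards1 card_completion andbT sub1set.
have [sXE cE] := completion_neq0 E0.
by rewrite /completion sXE cE eqxx !inE xX.
Qed.

Lemma card_completions E1 E2 X : #|completion E1 X :|: completion E2 X| <= 2.
Proof. by rewrite (leq_trans (leq_card_setU _ _)) // (leq_add (card_completion _ _) (card_completion _ _)). Qed.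

(* Two distinct pairs share at most one color, so at most one color has two completions. *)
Lemma few_completions E1 E2 a a' : a != a' ->
  1 < #|completion E1 [set a] :|: completion E2 [set a]| ->
  #|completion E1 [set a'] :|: completion E2 [set a']| <= 1.
Proof.
move=> aa' two; rewrite leqNgt; apply: contraL two => two'.
have full b E E' : 1 < #|completion E [set b] :|: completion E' [set b]| -> b \in E /\ #|E| = 2.
  move=> lt1; have : 0 < #|completion E [set b]|.
    rewrite lt0n; apply: contraL lt1 => /eqP/cards0_eq ->.
    by rewrite set0U -leqNgt card_completion.
  by case/completion_neq0; rewrite sub1set cards1.
rewrite -leqNgt leqNgt; apply/negP => two.
have eqE E : a \in E -> a' \in E -> #|E| = 2 -> E = [set a; a'].
  move=> aE a'E cE; apply/eqP; rewrite eq_sym eqEcard subUset !sub1set aE a'E cE.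
  by rewrite cards2 aa'.
have [a1 c1] := full _ _ _ two; have [a'1 _] := full _ _ _ two'.
rewrite setUC in two; rewrite setUC in two'.
have [a2 c2] := full _ _ _ two; have [a'2 _] := full _ _ _ two'.
by move: two; rewrite (eqE E1) // (eqE E2) // setUid ltnNge card_completion.
Qed.

Lemma pick_neq A a : 1 < #|A| -> exists2 b, b \in A & b != a.
Proof.
move=> lt1; have : 0 < #|A :\ a|.
  by move: lt1; rewrite (cardsD1 a A); case: (a \in A) => //; apply: ltnW.
by case/card_gt0P=> b; rewrite !inE => /andP[ba bA]; exists b.
Qed.

(** Three colors suffice to choose [a] so that no [b] completes it to [E]; then [b] has only [a] and
    the one completion of [a] to [F] to avoid. *)
Lemma color_edge A B E F : 2 < #|A| -> 2 < #|B| ->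
  exists a b, [/\ a \in A, b \in B & a != b] /\ ([set a; b] != E /\ [set a; b] != F).
Proof.
move=> lA lB; have [a aA a0] : exists2 a, a \in A & completion E [set a] = set0.
  have [cE|cE] := altP (#|E| =P 2); last first.
    have [a aA] : exists a, a \in A by apply/card_gt0P; apply: ltn_trans lA.
    by exists a; rewrite // /completion cards1 (negPf cE) andbF.
  have [a] : exists a, a \in A :\: E.
    apply/card_gt0P; rewrite cardsD subn_gt0 (leq_ltn_trans _ lA) // -cE.
    by rewrite subset_leq_card // subsetIr.
  by rewrite inE => /andP[aE aA]; exists a => //; rewrite /completion sub1set (negPf aE).
have [b] : exists b, b \in B :\: (a |: completion F [set a]).
  apply/card_gt0P; rewrite cardsD subn_gt0 (leq_ltn_trans _ lB) //.
  rewrite (leq_trans (subset_leq_card (subsetIr _ _))) // (leq_trans (leq_card_setU _ _)) //.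
  by rewrite cards1 ltnS card_completion.
rewrite !inE negb_or -andbA => /and3P[ba bF bB].
exists a, b; split; first by split; rewrite // eq_sym.
split; last by apply: contraNneq bF => <-; apply: mem_completion; rewrite ?inE // setUC.
apply/eqP => abE; have : b \in completion E [set a].
  by apply: mem_completion; rewrite ?inE // setUC.
by rewrite a0 inE.
Qed.

Lemma card_excluded P Q R a b :
  #|[set a; b] :|: P :|: Q :|: R| <= 2 + #|P| + #|Q| + #|R|.
Proof.
do 3 (rewrite (leq_trans (leq_card_setU _ _)) // leq_add2r).
by rewrite cards2; case: eqP.
Qed.

(** By [few_completions] each list has a color with at most one completion, and two different such
    colors give 2 + 1 + 1. It remains to treat the same color [a0] in both lists. *)
Lemma color_triangle_private A B E1 E2 F1 F2 : 1 < #|A| -> 1 < #|B| ->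
  exists a b, [/\ a \in A, b \in B & a != b] /\
    #|[set a; b] :|: (completion E1 [set a] :|: completion E2 [set a])
                 :|: (completion F1 [set b] :|: completion F2 [set b])| <= 4.
Proof.
move=> lA lB; set P := fun a => completion E1 [set a] :|: completion E2 [set a].
set Q := fun b => completion F1 [set b] :|: completion F2 [set b].
have few A' G1 G2 : 1 < #|A'| ->
    exists2 a, a \in A' & #|completion G1 [set a] :|: completion G2 [set a]| <= 1.
  case/card_gt1P=> a [a' [aA a'A aa']].
  case: (leqP #|completion G1 [set a] :|: completion G2 [set a]| 1) => [|lt1]; first by exists a.
  by exists a'; rewrite // (few_completions aa' lt1).
have le4 a b : a != b -> #|P a| + #|Q b| <= 2 -> #|[set a; b] :|: P a :|: Q b| <= 4.
  move=> ab le2; rewrite -[_ :|: Q b]setU0 (leq_trans (card_excluded _ _ _ _ _)) //.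
  by rewrite cards0 addn0 -addnA leq_add2l.
have [a0 a0A Pa0] := few A E1 E2 lA; have [b0 b0B Qb0] := few B F1 F2 lB.
have [ab0|ab0] := eqVneq a0 b0; last first.
  by exists a0, b0; split; rewrite // le4 // (leq_add Pa0 Qb0).
rewrite -{}ab0 in b0B Qb0.
have [a aA aa0] := pick_neq a0 lA; have [b bB ba0] := pick_neq a0 lB.
case: (leqP #|P a| 1) => [Pa|Pa].
  by exists a, a0; split; rewrite // le4 // (leq_add Pa Qb0).
have [a0P|a0P] := boolP (a0 \in P a).
  (* As [a0] is itself a completion of [a], it is counted twice, and the total drops to 3 + 1. *)
  exists a, a0; split=> //.
  have -> : [set a; a0] :|: P a :|: Q a0 = [set a] :|: P a :|: Q a0.
    congr (_ :|: _); rewrite -setUA; congr (_ :|: _); apply/setUidPr.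
    by rewrite sub1set.
  rewrite (leq_trans (leq_card_setU _ _)) // (@leq_add _ _ 3 1) //.
  by rewrite (leq_trans (leq_card_setU _ _)) // cards1 (@leq_add _ _ 1 2) // card_completions.
(* Now [E1] and [E2] are two pairs that contain [a] but not [a0], so [a0] has no completion, and 2 +
   0 + 2 is enough. *)
exists a0, b; split; first by rewrite eq_sym.
suff P0 : P a0 = set0.
  rewrite -/(P a0) P0.
  by rewrite setU0 (leq_trans (leq_card_setU _ _)) // cards2 (@leq_add _ _ 2 2) ?card_completions // eq_sym ba0.
have none E E' : a0 \notin completion E [set a] -> 1 < #|completion E [set a] :|: completion E' [set a]| ->
    completion E [set a0] = set0.
  move=> a0E lt1; apply: contraNeq a0E => /set0Pn[x xE].
  have [a0E cE] : [set a0] \subset E /\ #|E| = #|[set a0]|.+1.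
    by apply: completion_neq0; apply/card_gt0P; exists x.
  have : 0 < #|completion E [set a]|.
    rewrite lt0n; apply: contraL lt1 => /eqP/cards0_eq ->.
    by rewrite set0U -leqNgt card_completion.
  move=> E0; rewrite (completionE (x := a0) E0) ?inE ?eqxx //; first by rewrite -sub1set.
  by rewrite eq_sym.
move: a0P; rewrite inE negb_or => /andP[a0E1 a0E2].
by rewrite /P (none E1 E2) // (none E2 E1) ?setU0 // setUC.
Qed.

(** If every choice failed, colors [a1], [a2] of [A] with at most one completion would force the
    bound 2 + 1 + 1 + 1 to be attained without overlaps. Then [F] consists of two colors [b1], [b2]
    of [B], and [b2] completes both [[set b1]] to [F] and [[set a1; b1]] to [O], an overlap. *)
Lemma color_triangle_mixed A B E1 E2 F O : 2 < #|A| -> 1 < #|B| ->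
  exists a b, [/\ a \in A, b \in B & a != b] /\
    #|[set a; b] :|: (completion E1 [set a] :|: completion E2 [set a])
                 :|: completion F [set b] :|: completion O [set a; b]| <= 4.
Proof.
move=> lA lB; set P := fun a => completion E1 [set a] :|: completion E2 [set a].
set bad := fun a b => [set a; b] :|: P a :|: completion F [set b] :|: completion O [set a; b].
case: (boolP [exists a in A, exists b in B, (a != b) && (#|bad a b| <= 4)]).
  by case/exists_inP=> a aA /exists_inP[b bB /andP[ab le4]]; exists a, b.
move=> none; exfalso.
have gt4 a b : a \in A -> b \in B -> a != b -> 4 < #|bad a b|.
  move=> aA bB ab; rewrite ltnNge; apply: contra none => le4.
  by apply/exists_inP; exists a => //; apply/exists_inP; exists b; rewrite // ab.
have [a1 [a2 [a1A a2A a12 Pa1 Pa2]]] :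
    exists a1 a2, [/\ a1 \in A, a2 \in A, a1 != a2, #|P a1| <= 1 & #|P a2| <= 1].
  have [x [y [z [[xA yA zA] [xy yz zx]]]]] := card_gt2P lA.
  case: (leqP #|P x| 1) => Px; last first.
    by exists y, z; rewrite (few_completions _ Px) 1?(few_completions _ Px) // eq_sym.
  case: (leqP #|P y| 1) => Py; first by exists x, y.
  by exists x, z; rewrite Px (few_completions yz Py) eq_sym.
have tight a b : a \in A -> #|P a| <= 1 -> b \in B -> a != b ->
   [/\ 0 < #|completion F [set b]|, 0 < #|completion O [set a; b]|,
       a \notin completion F [set b] & [disjoint completion F [set b] & completion O [set a; b]]].
  move=> aA Pa bB ab; have lt4 := gt4 a b aA bB ab.
  have le5 := card_excluded (P a) (completion F [set b]) (completion O [set a; b]) a b.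
  have cF := card_completion F [set b]; have cO := card_completion O [set a; b].
  have {le5} : 4 < 2 + #|P a| + #|completion F [set b]| + #|completion O [set a; b]|.
    exact: leq_trans lt4 le5.
  move=> sum5; have F0 : 0 < #|completion F [set b]|.
    rewrite lt0n; apply: contraL sum5 => /eqP ->.
    by rewrite -leqNgt (@leq_add _ _ 3 1) // addn0 (@leq_add _ _ 2 1).
  have O0 : 0 < #|completion O [set a; b]|.
    rewrite lt0n; apply: contraL sum5 => /eqP ->.
    by rewrite -leqNgt addn0 (@leq_add _ _ 3 1) // (@leq_add _ _ 2 1).
  split=> //.
    apply: contraL lt4 => aF; rewrite -leqNgt.
    have -> : bad a b = [set a; b] :|: P a :|: completion O [set a; b].
      congr (_ :|: _); apply/setUidPl; rewrite (completionE F0 (x := a)) ?sub1set ?inE ?eqxx //.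
        by move: aF; rewrite /completion; case: ifP => _; rewrite !inE // => /andP[].
    rewrite -[_ :|: _ :|: _]setU0 (leq_trans (card_excluded _ _ _ _ _)) // cards0 addn0.
    by rewrite (@leq_add _ _ 3 1) // (@leq_add _ _ 2 1).
  rewrite -setI_eq0; apply: contraTT lt4 => /set0Pn[x]; rewrite inE => /andP[xF xO].
  rewrite -leqNgt.
  have sub1 E X : x \in completion E X -> completion E X = [set x].
    move=> xE; apply/eqP; rewrite eq_sym eqEcard sub1set xE cards1.
    exact: card_completion.
  have -> : bad a b = [set a; b] :|: P a :|: completion F [set b].
    by apply/setUidPl; rewrite (sub1 O) // sub1set inE xF orbT.
  rewrite -[_ :|: _ :|: _]setU0 (leq_trans (card_excluded _ _ _ _ _)) // cards0 addn0.
  by rewrite (@leq_add _ _ 3 1) // (@leq_add _ _ 2 1).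
have memF a b : a \in A -> #|P a| <= 1 -> b \in B -> a != b -> b \in F /\ #|F| = 2.
  move=> aA Pa bB ab; have [F0 _ _ _] := tight a b aA Pa bB ab.
  by have [] := completion_neq0 F0; rewrite sub1set cards1.
(* A color [a] of [B] would lie in [F] by tightness for [a'] and [a]; with another color [b] of [B]
   it would give [F = [set a; b]], so [a] would complete [b]. *)
have notB a a' : a \in A -> a' \in A -> a != a' -> #|P a| <= 1 -> #|P a'| <= 1 -> a \notin B.
  move=> aA a'A aa' Pa Pa'; apply/negP => aB.
  have [b bB ba] := pick_neq a lB.
  have [aF _] : a \in F /\ #|F| = 2 by apply: (memF a'); rewrite // eq_sym.
  have [F0 _ /negP[]] := tight a b aA Pa bB (negbT (etrans (eq_sym a b) (negPf ba))).
  by rewrite (completionE F0 aF) ?inE // eq_sym.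
have a1B := notB a1 a2 a1A a2A a12 Pa1 Pa2.
have [b1 [b2 [b1B b2B b12]]] := card_gt1P lB.
have ab b : b \in B -> a1 != b by apply: contraTneq => <-.
have [F0 O0 _] := tight a1 b1 a1A Pa1 b1B (ab _ b1B).
have [b2F _] := memF a1 b2 a1A Pa1 b2B (ab _ b2B).
have [_ O0' _ _] := tight a1 b2 a1A Pa1 b2B (ab _ b2B).
have [/subsetP sO _] := completion_neq0 O0'.
rewrite (completionE F0 b2F) ?inE 1?eq_sym //.
rewrite (completionE O0 (x := b2)) ?sO ?inE ?eqxx ?orbT //; last first.
  by rewrite negb_or eq_sym ab //= eq_sym.
by rewrite disjoints1 inE eqxx.
Qed.

(** A color [c] of [A] without completion to [E] can fail with all of [B] only if [c] is also the
    sole color of [B] without completion to [F]. Two further colors of [B] then make up [F] and,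
    together with [c], make up [O1], so the completions coincide and the count is 4 after all. *)
Lemma color_triangle_shared A B E F O1 O2 : 2 < #|A| -> 2 < #|B| ->
  exists a b, [/\ a \in A, b \in B & a != b] /\
    #|[set a; b] :|: completion E [set a] :|: completion F [set b]
       :|: (completion O1 [set a; b] :|: completion O2 [set a; b])| <= 4.
Proof.
move=> lA lB.
set bad := fun a b => [set a; b] :|: completion E [set a] :|: completion F [set b]
       :|: (completion O1 [set a; b] :|: completion O2 [set a; b]).
case: (boolP [exists a in A, exists b in B, (a != b) && (#|bad a b| <= 4)]).
  by case/exists_inP=> a aA /exists_inP[b bB /andP[ab le4]]; exists a, b.
move=> none; exfalso.
have gt4 a b : a \in A -> b \in B -> a != b -> 4 < #|bad a b|.
  move=> aA bB ab; rewrite ltnNge; apply: contra none => le4.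
  by apply/exists_inP; exists a => //; apply/exists_inP; exists b; rewrite // ab.
have clean A' G : 2 < #|A'| -> exists2 a, a \in A' & completion G [set a] = set0.
  move=> lA'; have [cG|cG] := altP (#|G| =P 2); last first.
    have [a aA] : exists a, a \in A' by apply/card_gt0P; apply: ltn_trans lA'.
    by exists a; rewrite // /completion cards1 (negPf cG) andbF.
  have [a] : exists a, a \in A' :\: G.
    apply/card_gt0P; rewrite cardsD subn_gt0 (leq_ltn_trans _ lA') // -cG.
    by rewrite subset_leq_card // subsetIr.
  by rewrite inE => /andP[aE aA]; exists a => //; rewrite /completion sub1set (negPf aE).
have [c cA Ec] := clean A E lA; have [c' c'B Fc'] := clean B F lB.
have eqc b : b \in B -> completion F [set b] = set0 -> b = c.
  move=> bB Fb; apply/eqP; apply: contraT => bc.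
  have := gt4 c b cA bB; rewrite eq_sym bc ltnNge /bad Ec Fb !setU0 => /(_ isT)/negP[].
  by rewrite (leq_trans (leq_card_setU _ _)) // (@leq_add _ _ 2 2) ?card_completions // cards2; case: eqP.
have {c' c'B Fc'} cB : c \in B by rewrite -(eqc c').
have [b1 [b2 [b1B b2B b12 b1c b2c]]] : exists b1 b2, [/\ b1 \in B, b2 \in B, b1 != b2, b1 != c & b2 != c].
  have : 1 < #|B :\ c| by move: lB; rewrite (cardsD1 c B) cB.
  by case/card_gt1P=> b1 [b2 []]; rewrite !inE => /andP[? ?] /andP[? ?] ?; exists b1, b2.
have F0 b : b \in B -> b != c -> 0 < #|completion F [set b]|.
  by move=> bB; rewrite card_gt0; apply: contra_neq; apply: eqc.
have [b2F _] : b2 \in F /\ #|F| = 2.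
  by have [] := completion_neq0 (F0 b2 b2B b2c); rewrite sub1set cards1.
have Fb1 : completion F [set b1] = [set b2].
  by rewrite (completionE (F0 b1 b1B b1c) b2F) ?inE // eq_sym.
have O1_0 b : b \in B -> b != c -> 0 < #|completion O1 [set c; b]|.
  move=> bB bc; have := gt4 c b cA bB; rewrite eq_sym bc => /(_ isT) lt4; rewrite lt0n.
  apply: contraL lt4 => /eqP/cards0_eq O0; rewrite -leqNgt /bad Ec O0 setU0 set0U.
  rewrite -[_ :|: _ :|: _]setU0 (leq_trans (card_excluded _ _ _ _ _)) // cards0 addn0.
  by rewrite (@leq_add _ _ 3 1) ?card_completion // (@leq_add _ _ 2 1) ?card_completion.
have [/subsetP sO _] := completion_neq0 (O1_0 b2 b2B b2c).
have O1b1 : completion O1 [set c; b1] = [set b2].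
  apply: completionE; rewrite ?O1_0 ?sO ?inE ?eqxx ?orbT //.
  by rewrite negb_or b2c eq_sym.
have := gt4 c b1 cA b1B; rewrite eq_sym b1c => /(_ isT); apply/negP; rewrite -leqNgt /bad Ec Fb1 O1b1.
rewrite setU0 setUA -(setUA [set c; b1]) setUid -[_ :|: _ :|: _]setU0.
rewrite (leq_trans (card_excluded _ _ _ _ _)) // cards0 addn0 cards1.
by rewrite (@leq_add _ _ 3 1) ?card_completion.
Qed.

End ColorLists.

(** * Reducible configurations *)

Section CliqueReductions.
Variables (T : finType) (e : rel T).
Hypotheses (e_sym : symmetric e) (e_irr : irreflexive e).
Implicit Types (phi k : T -> 'I_9) (X S : {set T}).

Lemma deleted_extension phi k S X : odd_good (delete e S) phi ->
  {in S &, injective k} ->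
  (forall s, s \in S -> k s \notin forbidden e phi S X s) ->
  (forall x, x \in S :|: X -> k @: (nb e x :&: S) != outer e phi S x) ->
  colorable e.
Proof.
move=> good_phi k_inj kF kX; exists (fun x => if x \in S then k x else phi x).
apply: odd_extension => //.
- exact: deleted_good_proper.
- by move=> s y sS yS esy; apply: forbidden_proper esy (kF s sS).
- exact: deleted_good_odd.
move=> x _ xSN; have [xSX|] := boolP (x \in S :|: X); first exact: kX.
rewrite inE negb_or => /andP[xS xX]; rewrite (negPf xS) in xSN.
apply: chosen_extension => // s; rewrite inE => /andP[exs sS].
by apply: forbidden_chosen (kF s sS); rewrite // e_sym; move: exs; rewrite inE.
Qed.

Lemma card_allowed (F : {set 'I_9}) m : #|F| + m < 9 -> m < #|~: F|.
Proof. by rewrite [#|~: F|]cardsCs setCK card_ord ltn_subRL addnC. Qed.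

Lemma reduce_five_five u v x y : #|nb e u| = 5 -> #|nb e v| = 5 -> e u v ->
  x != y -> e u x -> e v x -> e u y -> e v y ->
  colorable (delete e [set u; v]) -> colorable e.
Proof.
move=> du dv euv xy eux evx euy evy [phi good_phi].
pose S := [set u; v]; pose X := [set x; y].
have neq a b : e a b -> a != b by apply: contraTneq => ->; rewrite e_irr.
have out z : e u z -> e v z -> z \notin S.
  by move=> euz evz; rewrite !inE negb_or !(eq_sym z) !neq.
have XS z : z \in X -> z \notin S by case/set2P=> ->; apply: out.
(* At most four outside neighbors, two of them in [X], forbid at most 6 colors; three are left, as
   [color_edge] requires. *)
have allowed s : #|nb e s| = 5 -> nb e s :&: S != set0 -> X \subset nb e s ->
    2 < #|~: forbidden e phi S X s|.
  move=> ds sS sX; apply: card_allowed; have := card_forbidden e phi S X s.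
  have -> : X :&: (nb e s :\: S) = X.
    by apply/setIidPl/subsetP=> z zX; rewrite inE XS ?(subsetP sX).
  rewrite [#|X|]cards2 xy cardsD ds => le1; apply: (leq_ltn_trans le1).
  by rewrite (@leq_ltn_trans (2 * 4)) // leq_mul2l leq_subLR (@leq_add 1 4) // card_gt0.
have [| |a [b [[aA bB ab] [abx aby]]]] := @color_edge _ (~: forbidden e phi S X u)
  (~: forbidden e phi S X v) (outer e phi S x) (outer e phi S y).
- apply: allowed => //; last by rewrite subUset !sub1set !inE eux.
  by apply/set0Pn; exists v; rewrite !inE euv eqxx orbT.
- apply: allowed => //; last by rewrite subUset !sub1set !inE evx.
  by apply/set0Pn; exists u; rewrite !inE e_sym euv eqxx.
rewrite !inE in aA bB; have uv := neq _ _ euv.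
pose k z := if z == u then a else b.
have ku : k u = a by rewrite /k eqxx.
have kv : k v = b by rewrite /k eq_sym (negPf uv).
have k_inj : {in S &, injective k}.
  move=> s t; rewrite !inE => /orP[]/eqP-> /orP[]/eqP->; rewrite ?ku ?kv // => eqab;
    by rewrite eqab eqxx in ab.
apply: (@deleted_extension phi k S X) => //.
  by move=> s; rewrite !inE => /orP[]/eqP->; rewrite ?ku ?kv.
have common z : e u z -> e v z -> k @: (nb e z :&: S) = [set a; b].
  move=> euz evz; rewrite (_ : _ :&: _ = S) ?imsetU1 ?imset_set1 ?ku ?kv //.
  by apply/setIidPr; rewrite subUset !sub1set !inE !(e_sym z) euz.
move=> z; rewrite !inE => /orP[]/orP[]/eqP->.
- by apply: odd_degree_extension; rewrite ?du.
- by apply: odd_degree_extension; rewrite ?dv.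
- by rewrite common.
- by rewrite common.
Qed.

(** * A triangle of degrees 5, 6, 6 *)

Section Triangle.
Variables (v u w x y : T) (phi : T -> 'I_9).
Hypotheses (dv : #|nb e v| = 5) (du : #|nb e u| = 6) (dw : #|nb e w| = 6).
Hypotheses (evu : e v u) (evw : e v w) (euw : e u w).
Hypotheses (xy : x != y) (xw : x != w) (yu : y != u).
Hypotheses (evx : e v x) (eux : e u x) (evy : e v y) (ewy : e w y).
Let S := [set v; u; w].
Let X := [set x; y].
Hypothesis good_phi : odd_good (delete e S) phi.
Let O z := outer e phi S z.
Let F s := forbidden e phi S X s.

Let neq a b : e a b -> a != b.
Proof. by apply: contraTneq => ->; rewrite e_irr. Qed.

Let xS : x \notin S.
Proof. by rewrite !inE !negb_or xw !(eq_sym x) !neq. Qed.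

Let yS : y \notin S.
Proof. by rewrite !inE !negb_or yu !(eq_sym y) !neq. Qed.

(** The degree of [v] is odd, so [v] needs no condition. The other four, [x] and [y] exempted in [X]
    and the clique members [u] and [w] of even degree, need one each. *)
Lemma triangle_extension a b d :
  a \notin F u -> b \notin F w -> d \notin F v -> a != b -> d != a -> d != b ->
  d |: (a |: (if e w x then [set b] else set0)) != O x ->
  d |: (b |: (if e u y then [set a] else set0)) != O y ->
  d |: [set a] != O w -> d |: [set b] != O u -> colorable e.
Proof.
move=> aF bF dF ab da db Hx Hy Hw Hu.
have vu := neq evu; have vw := neq evw; have uw := neq euw.
pose k z := if z == v then d else if z == u then a else b.
have kv : k v = d by rewrite /k eqxx.
have ku : k u = a by rewrite /k eq_sym (negPf vu) eqxx.
have kw : k w = b by rewrite /k !(eq_sym w) (negPf vw) (negPf uw).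
have k_inj : {in S &, injective k}.
  move=> s t; rewrite !inE -!orbA => /or3P[]/eqP-> /or3P[]/eqP->; rewrite ?kv ?ku ?kw // => eqc;
    by move: ab da db; rewrite eqc eqxx.
have imS z : k @: (nb e z :&: S) =
    (if e z v then [set d] else set0) :|: ((if e z u then [set a] else set0)
      :|: (if e z w then [set b] else set0)).
  have only s : k @: (nb e z :&: [set s]) = if e z s then [set k s] else set0.
    case: ifP => ezs; last first.
      rewrite (_ : _ :&: _ = set0) ?imset0 //; apply/setP=> t; rewrite !inE.
      by case: eqP => [->|]; rewrite ?ezs ?andbF.
    by rewrite (setIidPr _) ?imset_set1 // sub1set inE.
  by rewrite !setIUr !imsetU !only kv ku kw setUA.
apply: (@deleted_extension phi k S X) => //.
  by move=> s; rewrite !inE -orbA => /or3P[]/eqP->; rewrite ?ku ?kv ?kw.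
move=> z; rewrite inE [z \in S]inE [_ \in [set _; _]]inE [z \in X]inE !in_set1.
rewrite -!orbA => /or3P[/eqP->|/eqP->|/or3P[]/eqP->].
- by apply: odd_degree_extension; rewrite ?dv.
- by rewrite imS e_irr (e_sym u v) evu euw set0U.
- by rewrite imS e_irr !(e_sym w) evw euw setU0.
- by rewrite imS !(e_sym x) evx eux.
- by rewrite imS !(e_sym y) evy ewy (setUC _ [set b]).
Qed.

(** Two neighbors of [s] inside the clique save 4 of the [2 * #|nb e s|] forbidden colors, and each
    neighbor in [X] saves one more. *)
Let allowed s a b : a != b -> [set a; b] \subset nb e s :&: S ->
  9 + #|X :&: nb e s| + 4 <= #|~: F s| + 2 * #|nb e s|.
Proof.
move=> ab /subset_leq_card; rewrite cards2 ab => le2.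
have := card_forbidden e phi S X s; rewrite -/(F s).
rewrite (_ : X :&: (nb e s :\: S) = X :&: nb e s); last first.
  apply/setP=> z; rewrite !in_setI in_setD; have [/set2P[]->|//] := boolP (z \in X).
    by rewrite xS.
  by rewrite yS.
by move: le2; have := cardsID S (nb e s); have := cardsC (F s); rewrite card_ord; clear; lia.
Qed.

Lemma reduce_triangle : colorable e.
Proof.
have vu := neq evu; have vw := neq evw; have uw := neq euw.
have XN s : #|X :&: nb e s| = e s x + e s y.
  have only z : #|[set z] :&: nb e s| = e s z.
    case: (boolP (e s z)) => esz; first by rewrite (setIidPl _) ?cards1 // sub1set inE.
    by apply: eq_card0 => t; rewrite !inE; case: eqP => // ->; apply: negPf.
  rewrite setIUl cardsU !only (_ : _ :&: _ = set0) ?cards0 ?subn0 //.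
  by apply/setP=> z; rewrite !inE; case: eqP => // ->; rewrite (negPf xy) andbF.
(* Three outside neighbors, two of them in [X], forbid at most 4 colors, so [v] keeps 5. It is
   colored last, whence the bound 4 on the excluded colors in the list lemmas. *)
have Av : 4 < #|~: F v|.
  have := allowed (s := v) uw; rewrite XN evx evy dv subUset !sub1set !inE evu evw !eqxx !orbT.
  by move/(_ isT); clear; lia.
have Au : 1 + e u y < #|~: F u|.
  have := allowed (s := u) vw; rewrite XN eux du subUset !sub1set !inE euw (e_sym u) evu !eqxx !orbT.
  by move/(_ isT); clear; lia.
have Aw : 1 + e w x < #|~: F w|.
  have := allowed (s := w) vu; rewrite XN ewy dw subUset !sub1set !inE !(e_sym w) euw evw !eqxx !orbT.
  by move/(_ isT); rewrite (e_sym x); clear; lia.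
have finish a b (bad : {set 'I_9}) : a \in ~: F u -> b \in ~: F w -> a != b ->
    #|bad| <= 4 ->
    (forall d, d \notin bad ->
      [/\ d != a, d != b, d \notin completion (O w) [set a], d \notin completion (O u) [set b]
        & d \notin completion (O x) (a |: (if e w x then [set b] else set0)) /\
          d \notin completion (O y) (b |: (if e u y then [set a] else set0))]) -> colorable e.
  rewrite !inE => aF bF ab le4 ok.
  have [d] : exists d, d \in ~: F v :\: bad.
    apply/card_gt0P; rewrite cardsD subn_gt0 (leq_ltn_trans _ Av) // (leq_trans _ le4) //.
    by rewrite subset_leq_card // subsetIr.
  rewrite !inE => /andP[dbad dF]; have [da db dw' du' [dx dy]] := ok d dbad.
  have avoid (A E : {set 'I_9}) : d \notin A -> d \notin completion E A -> d |: A != E.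
    by move=> dA; apply: contra => /eqP; apply: mem_completion.
  by apply: (triangle_extension aF bF dF) => //; apply: avoid;
    rewrite // ?in_setU ?negb_or ?in_set1 ?da ?db //; case: ifP; rewrite inE.
(* Each extra adjacency, [x] with [w] or [y] with [u], adds one color to a list and turns a
   condition on one of the colors [a], [b] into a condition on both. *)
have [ewx|/negPf newx] := boolP (e w x); have [euy|/negPf neuy] := boolP (e u y);
  rewrite ?ewx ?newx ?euy ?neuy /= in Au Aw.
- have [a [b [[aA bB ab] le4]]] := color_triangle_shared (O w) (O u) (O x) (O y) Au Aw.
  apply: finish aA bB ab le4 _ => d.
  rewrite ewx euy (setUC [set b]) !in_setU !in_set1 !negb_or -!andbA.
  by case/and5P=> -> -> -> -> /andP[-> ->].
- have [b [a [[bB aA ba] le4]]] := color_triangle_mixed (O y) (O u) (O w) (O x) Aw Au.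
  have ab : a != b by rewrite eq_sym.
  apply: finish aA bB ab le4 _ => d.
  rewrite ewx neuy setU0 (setUC [set a]) !in_setU !in_set1 !negb_or -!andbA.
  by case/and5P=> -> -> -> -> /andP[-> ->].
- have [a [b [[aA bB ab] le4]]] := color_triangle_mixed (O x) (O w) (O u) (O y) Au Aw.
  apply: finish aA bB ab le4 _ => d.
  rewrite euy newx setU0 (setUC [set b]) !in_setU !in_set1 !negb_or -!andbA.
  by case/and5P=> -> -> -> -> /andP[-> ->].
have [a [b [[aA bB ab] le4]]] := color_triangle_private (O x) (O w) (O y) (O u) Au Aw.
apply: finish aA bB ab le4 _ => d.
rewrite neuy newx !setU0 !in_setU !in_set1 !negb_or -!andbA.
by case/and5P=> -> -> -> -> /andP[-> ->].
Qed.

End Triangle.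

Lemma reduce_five_six_six v u w x y :
  #|nb e v| = 5 -> #|nb e u| = 6 -> #|nb e w| = 6 -> e v u -> e v w -> e u w ->
  x != y -> x != w -> y != u -> e v x -> e u x -> e v y -> e w y ->
  colorable (delete e [set v; u; w]) -> colorable e.
Proof.
move=> dv du dw evu evw euw xy xw yu evx eux evy ewy [phi good_phi].
exact: (reduce_triangle dv du dw evu evw euw xy xw yu evx eux evy ewy good_phi).
Qed.
End CliqueReductions.

(** * Discharging *)

Lemma double_count (T1 T2 : finType) (A : {set T1}) (B : {set T2}) (r : T1 -> T2 -> bool) :
  \sum_(x in A) #|[set y in B | r x y]| = \sum_(y in B) #|[set x in A | r x y]|.
Proof.
have E (T3 T4 : finType) (A' : {set T3}) (B' : {set T4}) (r' : T3 -> T4 -> bool) :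
    \sum_(x in A') #|[set y in B' | r' x y]| = \sum_(x in A') \sum_(y in B') r' x y.
  apply: eq_bigr => x _; rewrite -sum1_card big_mkcond [RHS]big_mkcond /=.
  by apply: eq_bigr => y _; rewrite inE; do 2!case: ifP => //=; case: (r' _ _); rewrite ?andbF.
by rewrite E (E _ _ _ _ (fun y x => r x y)) exchange_big.
Qed.

Section Faces.
Variables (T : finType) (e : rel T).
Hypotheses (e_sym : symmetric e) (e_irr : irreflexive e).
Implicit Types (S : {set T * T}) (v u w x y p q : T).

(* Subgraphs are symmetric sets of darts, so a face of length l has 2 l elements. *)
Definition darts : {set T * T} := [set d | e d.1 d.2].

Definition even_subgraph S := [/\ S \subset darts,
  forall x y, (x, y) \in S -> (y, x) \in S &
  forall x, ~~ odd #|[set y | (x, y) \in S]|].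

Definition triangle v p q : {set T * T} :=
  [set (v, p); (p, v); (v, q); (q, v); (p, q); (q, p)].

Lemma triangleC v p q : triangle v p q = triangle v q p.
Proof. by apply/setP=> d; rewrite !inE; do 6!case: (d == _). Qed.

Lemma triangle_rot v p q : triangle v p q = triangle p q v.
Proof. by apply/setP=> d; rewrite !inE; do 6!case: (d == _). Qed.

Lemma even_next S v p : even_subgraph S -> (v, p) \in S -> exists2 q, q != p & (v, q) \in S.
Proof.
case=> _ _ /(_ v) evS vp; have : p \in [set y | (v, y) \in S] by rewrite inE.
move=> pS; rewrite (cardsD1 p) pS /= negbK in evS.
have /card_gt0P[q] : 0 < #|[set y | (v, y) \in S] :\ p| by rewrite odd_gt0.
by rewrite !inE => /andP[qp vq]; exists q.
Qed.

(** An edge of an even subgraph continues at both of its ends. The case [q = r] is the triangle. *)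
Lemma even_six S v p : even_subgraph S -> (v, p) \in S ->
  exists q r, [/\ q != p, r != v &
    uniq [:: (v, p); (p, v); (v, q); (q, v); (p, r); (r, p)]] /\
    [set d in [:: (v, p); (p, v); (v, q); (q, v); (p, r); (r, p)]] \subset S.
Proof.
move=> evS vp; have [sD symS _] := evS.
have neq x y : (x, y) \in S -> x != y.
  by move/(subsetP sD); rewrite inE /=; apply: contraTneq => ->; rewrite e_irr.
have [q qp vq] := even_next evS vp; have [r rv pr] := even_next evS (symS _ _ vp).
exists q, r; split.
  split=> //; rewrite /= !inE !xpair_eqE !negb_or.
  have := neq _ _ vp; have := neq _ _ vq; have := neq _ _ pr.
  rewrite !(eq_sym p) !(eq_sym v) (negPf qp) (negPf rv) !eqxx => /negPf-> /negPf-> /negPf->.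
  by rewrite ?andbF ?andbT ?(eq_sym p) ?qp ?rv //=; case: eqP => //= _; rewrite ?rv.
apply/subsetP=> d; rewrite !inE.
by do 5![case/orP => [/eqP->|]; auto]; move/eqP->; auto.
Qed.

Lemma even_ge6 S : even_subgraph S -> S != set0 -> 6 <= #|S|.
Proof.
move=> evS /set0Pn[[v p] vp]; have [q [r [[_ _ un] /subset_leq_card]]] := even_six evS vp.
by rewrite cardsE (card_uniqP un).
Qed.

Lemma even_triangle S v p : even_subgraph S -> (v, p) \in S -> #|S| = 6 ->
  exists q, S = triangle v p q.
Proof.
move=> evS vp cS; have [sD symS _] := evS.
have [q [r [[qp rv un] sub]]] := even_six evS vp.
have eqS : [set d in [:: (v, p); (p, v); (v, q); (q, v); (p, r); (r, p)]] = S.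
  by apply/eqP; rewrite eqEcard sub cS cardsE (card_uniqP un).
have qv : (q, v) \in S by rewrite -eqS !inE eqxx !orbT.
have q_v : q != v.
  by move/(subsetP sD): qv; rewrite inE /=; apply: contraTneq => ->; rewrite e_irr.
(* Evenness at [q] asks for a second edge there, and among the six darts only [(r, p)] can start at
   [q], so [q = r]. *)
have [z zv zS] := even_next evS qv; move: zS; rewrite -eqS !inE !xpair_eqE (negPf qp) (negPf q_v) (negPf zv).
rewrite ?andbF ?andbT /= => /andP[/eqP qr _].
by exists q; rewrite -qr; apply/setP=> d; rewrite !inE !orbA.
Qed.

Lemma even_card S : even_subgraph S -> ~~ odd #|S|.
Proof.
case=> _ _ evS; have -> : #|S| = \sum_x #|[set y | (x, y) \in S]|.
  rewrite -sum1_card (eq_bigr (fun x => \sum_(y | (x, y) \in S) 1)) => [|x _].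
    by rewrite pair_big_dep /=; apply: eq_bigl => -[x y].
  by rewrite sum1_card cardsE.
by apply: (big_ind (fun n => ~~ odd n)) => // m n; rewrite oddD => /negPf-> /negPf->.
Qed.

End Faces.

(** * Charges and their redistribution *)

Section Discharging.
Variables (T : finType) (e : rel T) (FF : {set {set T * T}}).
Hypotheses (e_sym : symmetric e) (e_irr : irreflexive e).
Implicit Types (S : {set T * T}) (v u w x y p q : T).

Let deg v := #|nb e v|.
Let D := darts e.
Let supp := [set v | nb e v != set0].
Let faces d := [set S in FF | d \in S].

Hypothesis FF_even : forall S, S \in FF -> even_subgraph e S.
Hypothesis FF_neq0 : set0 \notin FF.
Hypothesis FF_le2 : forall d, #|faces d| <= 2.
Hypothesis euler : #|D| + 2 <= 2 * #|FF| + 2 * #|supp|.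

Hypothesis deg_ge5 : forall v, v \in supp -> 5 <= deg v.
Hypothesis five_odd : forall v, deg v = 5 -> #|[set x in nb e v | odd (deg x)]| <= 1.
Hypothesis five_five : forall u v x y, deg u = 5 -> deg v = 5 -> e u v -> x != y ->
  e u x -> e v x -> e u y -> e v y -> False.
Hypothesis five_six_six : forall v u w x y, deg v = 5 -> deg u = 6 -> deg w = 6 ->
  e v u -> e v w -> e u w -> x != y -> x != w -> y != u ->
  e v x -> e u x -> e v y -> e w y -> False.

Let five := [set v | deg v == 5].
Let touched S := [set v | [exists y, (v, y) \in S]].
Let rich v := [exists S in FF, (6 < #|S|) && (v \in touched S)] || [exists y in nb e v, #|faces (v, y)| < 2].
Let five1 := [set v in five | rich v].
Let five0 := [set v in five | ~~ rich v].
Let big := [set v | 7 < deg v].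

Let neq x y : e x y -> x != y.
Proof. by apply: contraTneq => ->; rewrite e_irr. Qed.

Let in_supp x y : e x y -> x \in supp.
Proof. by move=> exy; rewrite inE; apply/set0Pn; exists y; rewrite inE. Qed.

Let face_dart S x y : S \in FF -> (x, y) \in S -> e x y.
Proof. by move=> /FF_even[/subsetP sD _ _] /sD; rewrite inE. Qed.

Let face_ge6 S : S \in FF -> 6 <= #|S|.
Proof.
move=> SF; apply: (even_ge6 e_irr (FF_even SF)).
by apply: contraNneq FF_neq0 => <-.
Qed.

Let card_darts : #|D| = \sum_(v in supp) deg v.
Proof.
rewrite -sum1_card (eq_bigl (fun d => e d.1 d.2)); last by move=> d; rewrite inE.
rewrite -(pair_big_dep predT e (fun _ _ => 1)) /= [LHS](bigID (mem supp)) /=.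
rewrite [X in _ + X]big1 ?addn0 => [|v vs]; last first.
  by rewrite big1 // => y /in_supp; rewrite (negPf vs).
by apply: eq_bigr => v _; rewrite sum1_card /deg cardsE.
Qed.

(** Each of the [n] 5-vertices on [S] starts two darts of [S] and ends two, and it has at most one
    neighbor of degree 5, so at least [3 * n] darts have an end among them. As [#|S|] is even and at
    least 8, this gives [n + 6 <= #|S|]: the face can pay 1 to each. *)
Let few_fives S : S \in FF -> 6 < #|S| -> #|five :&: touched S| + 6 <= #|S|.
Proof.
move=> SF lt6; have evS := FF_even SF; have [_ symS evenS] := evS.
pose A := [set d in S | d.1 \in five]; pose B := [set d in S | d.2 \in five].
have cAB : #|A| = #|B|.
  have inj : injective (fun d : T * T => (d.2, d.1)) by move=> [? ?] [? ?] [-> ->].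
  rewrite -(card_imset A inj); apply: eq_card => d; apply/imsetP/idP => [[c]|].
    by rewrite !inE => /andP[cS c5] -> /=; rewrite c5 symS // -surjective_pairing.
  rewrite !inE => /andP[dS d5]; exists (d.2, d.1); last by case: d {dS d5}.
  by rewrite !inE d5 symS // -surjective_pairing.
have sAB : #|A :|: B| <= #|S|.
  by apply: subset_leq_card; apply/subsetP=> d; rewrite !inE => /orP[] /andP[].
have rows (C : {set T}) : #|[set d in S | (d.1 \in five) && (d.2 \in C)]| =
    \sum_(x in five :&: touched S) #|[set y in C | (x, y) \in S]|.
  rewrite -sum1_card (eq_bigr (fun x => \sum_(y | (y \in C) && ((x, y) \in S)) 1)) => [|x _].
    rewrite pair_big_dep /=; apply: eq_bigl => -[x y]; rewrite !inE /= andbC.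
    case: (boolP ((x, y) \in S)) => xyS; rewrite ?andbF // !andbT.
    by rewrite (_ : [exists z, (x, z) \in S]) ?andbT //; apply/existsP; exists y.
  by rewrite sum1_card cardsE.
have leA : 2 * #|five :&: touched S| <= #|A|.
  have -> : A = [set d in S | (d.1 \in five) && (d.2 \in [set: T])].
    by apply/setP=> d; rewrite !inE andbT.
  rewrite rows mulnC -sum_nat_const; apply: leq_sum => x; rewrite !inE => /andP[_ /existsP[y xy]].
  have [z zy xz] := even_next evS xy.
  rewrite (leq_trans _ (subset_leq_card (_ : [set y; z] \subset _))) ?cards2 1?eq_sym ?zy //.
  by rewrite subUset !sub1set !inE xy xz.
have leAB : #|A :&: B| <= #|five :&: touched S|.
  have -> : A :&: B = [set d in S | (d.1 \in five) && (d.2 \in five)].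
    by apply/setP=> d; rewrite !inE andbACA andbb.
  rewrite rows -sum1_card; apply: leq_sum => x; rewrite !inE => /andP[/eqP x5 _].
  rewrite (leq_trans _ (five_odd x5)) //; apply: subset_leq_card; apply/subsetP=> y.
  by rewrite !inE => /andP[/eqP -> /(face_dart SF) ->].
have := cardsUI A B; have := even_card evS; move: lt6 cAB sAB leA leAB; clear; lia.
Qed.

(** Faces pay [P] and edges pay [Q]. The charge [4 - 2 c] of an edge is split evenly over its two
    darts, so either end can receive [2 - c]. *)
Let card_five1 : #|five1| + 6 * #|FF| <= 2 * #|D|.
Proof.
pose P := \sum_(S in FF | 6 < #|S|) #|five :&: touched S|.
pose Q := \sum_(d in D) (2 - #|faces d|).
have le1 : #|five1| <= P + Q.
  have sub : five1 \subset (\bigcup_(S in FF | 6 < #|S|) (five :&: touched S))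
      :|: [set d.1 | d in [set d in D | #|faces d| < 2]].
    apply/subsetP=> v; rewrite !inE => /andP[v5 /orP[/exists_inP[S SF /andP[lt6 vS]]|/exists_inP[y vy lt2]]].
      by apply/orP; left; apply/bigcupP; exists S; rewrite ?SF // !inE v5; rewrite inE in vS.
    by apply/orP; right; apply/imsetP; exists (v, y) => //; rewrite !inE lt2 andbT; rewrite inE in vy.
  rewrite (leq_trans (subset_leq_card sub)) // (leq_trans (leq_card_setU _ _)) // leq_add //.
    rewrite /P; elim/big_ind2: _ => [|A m B n Am Bn|//]; first by rewrite cards0.
    by rewrite (leq_trans (leq_card_setU _ _)) // leq_add.
  rewrite (leq_trans (leq_imset_card _ _)) // -sum1_card big_mkcond /Q [X in _ <= X]big_mkcond.
  by apply: leq_sum => d _; rewrite inE; case: (d \in D) => //=; case: ifP => //; rewrite subn_gt0.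
have leP : P + 6 * #|FF| <= \sum_(S in FF) #|S|.
  rewrite /P big_mkcondr mulnC -sum_nat_const -big_split /=; apply: leq_sum => S SF.
  by case: ifP => [/(few_fives SF)//|_]; exact: face_ge6.
have leQ : Q + \sum_(S in FF) #|S| = 2 * #|D|.
  have -> : \sum_(S in FF) #|S| = \sum_(d in D) #|faces d|.
    rewrite -(double_count FF D (fun S d => d \in S)); apply: eq_bigr => S /FF_even[sD _ _].
    by apply: eq_card => d; rewrite !inE; case: (boolP (d \in S)) => [/(subsetP sD)|]; rewrite ?inE ?andbF // => ->.
  by rewrite /Q -big_split mulnC -sum_nat_const /=; apply: eq_bigr => d _; rewrite subnK.
by move: le1 leP leQ; clear; lia.
Qed.

(** Membership [q \in link v p] stands for [p] and [q] being consecutive around [v]; no cyclic order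
    is ever constructed. *)
Let link v p := [set q | triangle v p q \in FF].

Let triangle_edges v p q : triangle v p q \in FF -> [/\ e v p, e v q & e p q].
Proof. by move=> tF; split; apply: (face_dart tF); rewrite !inE eqxx ?orbT. Qed.

Let linkC v p q : (q \in link v p) = (p \in link v q).
Proof. by rewrite !inE triangleC. Qed.

Let triangle_inj v p q q' : v != p -> q != v -> q != p ->
  triangle v p q = triangle v p q' -> q = q'.
Proof.
move=> vp qv qp eqt; have : (v, q) \in triangle v p q' by rewrite -eqt !inE eqxx !orbT.
rewrite !inE !xpair_eqE eqxx (negPf vp) (negPf qp) (negPf qv) ?andbF /= ?orbF.
by move/eqP.
Qed.

Let card_link v p : #|link v p| <= 2.
Proof.
apply: leq_trans (FF_le2 (v, p)).
rewrite -(card_in_imset (f := triangle v p)); last first.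
  move=> q q'; rewrite !inE => /triangle_edges[vp vq pq] _.
  by apply: triangle_inj; [exact: neq | rewrite eq_sym; exact: neq | rewrite eq_sym; exact: neq].
apply: subset_leq_card; apply/subsetP=> S /imsetP[q]; rewrite inE => tF ->.
by rewrite !inE tF eqxx.
Qed.

Let poor_link v p : v \in five0 -> e v p -> #|link v p| = 2.
Proof.
rewrite !inE => /andP[_]; rewrite negb_or => /andP[/exists_inPn noS /exists_inPn noy] evp.
apply/eqP; rewrite eqn_leq card_link /=.
have := noy p; rewrite inE -leqNgt => /(_ evp) ge2; apply: leq_trans ge2 _.
rewrite -(card_in_imset (f := triangle v p) (D := mem (link v p))); last first.
  move=> q q'; rewrite !inE => /triangle_edges[vp vq pq] _.
  by apply: triangle_inj; [exact: neq | rewrite eq_sym; exact: neq | rewrite eq_sym; exact: neq].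
apply: subset_leq_card; apply/subsetP=> S; rewrite inE => /andP[SF vpS].
have := noS S SF; rewrite negb_and -leqNgt inE => /orP[le6|/existsPn/(_ p)]; last by rewrite vpS.
have [|q SE] := even_triangle e_irr (FF_even SF) vpS.
  by apply/eqP; rewrite eqn_leq le6 face_ge6.
by apply/imsetP; exists q; rewrite // inE -SE.
Qed.

Let poor_no_five v p : v \in five0 -> e v p -> deg p != 5.
Proof.
move=> v0 evp; apply/eqP => p5; have v5 : deg v = 5 by move: v0; rewrite !inE => /andP[/eqP].
have /card_gt1P[x [y [xl yl xy]]] : 1 < #|link v p| by rewrite poor_link.
move: xl yl; rewrite !inE => /triangle_edges[_ vx px] /triangle_edges[_ vy py].
exact: (five_five v5 p5 evp xy).
Qed.

Let link_nb v p q : q \in link v p -> [/\ e v p, e v q, e p q & q != p].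
Proof.
by rewrite inE => /triangle_edges[vp vq pq]; split; rewrite // eq_sym neq.
Qed.

Let link_other v p q : v \in five0 -> q \in link v p -> exists2 x, x != q & link v p = [set q; x].
Proof.
move=> v0 ql; have [evp _ _ _] := link_nb ql.
have /eqP/cards2P[x [y [xy lE]]] := poor_link v0 evp.
by move: ql; rewrite lE => /set2P[]->; [exists y; rewrite // eq_sym | exists x; rewrite // setUC].
Qed.

(** The triangles on the other sides of [vp] and [vq] have third vertices [x] and [y]. If they
    differ, [five_six_six] applies. Otherwise [p], [q], [x] close up around [v], and the two
    remaining neighbors cannot have two links each. *)
Let poor_six v p q : v \in five0 -> deg p = 6 -> deg q = 6 -> q \notin link v p.
Proof.
move=> v0 p6 q6; apply/negP => ql; have v5 : deg v = 5 by move: v0; rewrite !inE => /andP[/eqP].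
have pl : p \in link v q by rewrite linkC.
have [evp evq epq qp] := link_nb ql.
have [x xq lp] := link_other v0 ql; have [y yp lq] := link_other v0 pl.
have xl : x \in link v p by rewrite lp !inE eqxx orbT.
have yl : y \in link v q by rewrite lq !inE eqxx orbT.
have [_ evx epx xp] := link_nb xl; have [_ evy eqy yq] := link_nb yl.
have [xy|xy] := eqVneq x y; last exact: (five_six_six v5 p6 q6 evp evq epq xy xq yp).
rewrite -{y}xy in yp lq yl evy eqy yq.
have lx : link v x = [set p; q].
  apply/eqP; rewrite eq_sym eqEcard poor_link // cards2 eq_sym qp andbT.
  by rewrite subUset !sub1set !(linkC v x) xl yl.
pose R := nb e v :\: [set p; q; x].
have cR : #|R| = 2.
  have sub : [set p; q; x] \subset nb e v by rewrite !subUset !sub1set !inE evp evq evx.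
  rewrite cardsD (setIidPr sub) -/(deg v) v5 -setUA cardsU1 cards2 !inE !negb_or.
  by rewrite eq_sym qp eq_sym xp eq_sym xq.
have [r rR] : exists r, r \in R by apply/card_gt0P; rewrite cR.
have sub : link v r \subset R :\ r.
  apply/subsetP=> s sr; have [evr evs _ s_r] := link_nb sr.
  move: rR; rewrite !inE evs andbT !negb_or -!andbA s_r /= => /and4P[rp rq rx _].
  apply/and3P; split; apply/eqP => sE; move: sr; rewrite sE linkC ?lp ?lq ?lx !inE.
  - by rewrite (negPf rq) (negPf rx).
  - by rewrite (negPf rp) (negPf rx).
  - by rewrite (negPf rp) (negPf rq).
have := subset_leq_card sub; rewrite poor_link //; last by move: rR; rewrite !inE => /andP[].
by have := cardsD1 r R; rewrite rR cR; clear; lia.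
Qed.

(** Neighbors of degree 6 are never consecutive around [v], so at most two of the five have degree
    6; at most one is odd, and the remaining ones have degree at least 8. *)
Let poor_big v : v \in five0 -> 2 <= #|nb e v :&: big|.
Proof.
move=> v0; have v5 : deg v = 5 by move: v0; rewrite !inE => /andP[/eqP].
pose I := [set p in nb e v | deg p == 6].
have cover : nb e v \subset (I :|: [set x in nb e v | odd (deg x)]) :|: (nb e v :&: big).
  apply/subsetP=> p; rewrite !inE => evp; rewrite evp /=.
  have := poor_no_five v0 evp; have := deg_ge5 (in_supp (etrans (e_sym p v) evp)).
  by case: (deg p) => [|[|[|[|[|[|[|[|?]]]]]]]] //= _ _; rewrite !orbT.
have := subset_leq_card cover; rewrite -/(deg v) v5.
have le2 : #|I| <= 2.
  have count : \sum_(p in I) #|[set q in nb e v :\: I | q \in link v p]| <= 2 * #|nb e v :\: I|.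
    rewrite double_count mulnC -sum_nat_const; apply: leq_sum => q _.
    apply: leq_trans (card_link v q); apply: subset_leq_card; apply/subsetP=> p.
    by rewrite inE linkC => /andP[].
  have countI : \sum_(p in I) #|[set q in nb e v :\: I | q \in link v p]| = 2 * #|I|.
    rewrite mulnC -sum_nat_const; apply: eq_bigr => p; rewrite inE => /andP[evp /eqP p6].
    rewrite -(poor_link v0 (p := p)); last by rewrite inE in evp.
    apply: eq_card => q; rewrite in_set; case: (boolP (q \in link v p)) => ql; rewrite ?andbF // andbT.
    have [_ evq _ _] := link_nb ql; rewrite !inE evq /= andbT; apply/negP => /eqP q6.
    by move: ql; rewrite (negPf (poor_six v0 p6 q6)).
  have := cardsID I (nb e v); rewrite -/(deg v) v5 (setIidPr _); last first.
    by apply/subsetP=> p; rewrite inE => /andP[].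
  by move: count; rewrite countI; clear; lia.
have := five_odd v5.
have [+ _] := leq_card_setU (I :|: [set x in nb e v | odd (deg x)]) (nb e v :&: big).
have [+ _] := leq_card_setU I [set x in nb e v | odd (deg x)].
by move: le2; clear; lia.
Qed.

(** Poor vertices are never consecutive around [w], so they are at most half of its neighbors. At
    1/2 each, [w] gives away at most [deg w / 4], which is at most [deg w - 6] from degree 8 on. *)
Let few_poor w : 2 * #|nb e w :&: five0| <= deg w.
Proof.
pose X := nb e w :&: five0.
have : \sum_(a in X) #|[set q in nb e w :\: five0 | q \in link a w]| <= 2 * #|nb e w :\: five0|.
  rewrite double_count mulnC -sum_nat_const; apply: leq_sum => q _.
  apply: leq_trans (card_link w q); apply: subset_leq_card; apply/subsetP=> a.
  by rewrite in_set => /andP[_]; rewrite [q \in _]inE [a \in link _ _]inE triangle_rot.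
have -> : \sum_(a in X) #|[set q in nb e w :\: five0 | q \in link a w]| = 2 * #|X|.
  rewrite mulnC -sum_nat_const; apply: eq_bigr => a; rewrite in_setI => /andP[ewa a0].
  have eaw : e a w by rewrite e_sym; rewrite inE in ewa.
  rewrite -(poor_link a0 eaw); apply: eq_card => q; rewrite in_set.
  case: (boolP (q \in link a w)) => ql; rewrite ?andbF // andbT.
  have [_ eaq ewq _] := link_nb ql; rewrite in_setD [q \in nb e w]inE ewq andbT.
  by apply: contra (poor_no_five a0 eaq); rewrite !inE => /andP[].
have := cardsID five0 (nb e w); rewrite -/X -/(deg w); clear; lia.
Qed.

Lemma discharging : False.
Proof.
have le0 : #|five0| <= \sum_(w in big) (deg w - 6).
  have : \sum_(v in five0) #|[set w in big | e v w]| <= \sum_(w in big) 2 * (deg w - 6).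
    rewrite double_count; apply: leq_sum => w; rewrite inE => w8.
    have := few_poor w; rewrite setIC (_ : _ :&: _ = [set x in five0 | e x w]) /=; last first.
      by apply/setP=> x; rewrite [RHS]in_set in_setI [x \in nb e w]inE e_sym.
    by move: w8; clear; lia.
  have : \sum_(v in five0) 2 <= \sum_(v in five0) #|[set w in big | e v w]|.
    apply: leq_sum => v /poor_big; rewrite setIC (_ : _ :&: _ = [set w in big | e v w]) //.
    by apply/setP=> w; rewrite [RHS]in_set in_setI [w \in nb e v]inE.
  rewrite sum_nat_const -big_distrr /=; clear; lia.
have cfive : #|five| = #|five0| + #|five1|.
  rewrite -(cardsID five1 five) addnC; congr (_ + _); apply: eq_card => v.
    by rewrite in_setD [v \in five1]in_set [v \in five0]in_set; case: (v \in five); rewrite ?andbT.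
  by rewrite in_setI [v \in five1]in_set; case: (v \in five).
have : 6 * #|supp| + \sum_(w in big) (deg w - 6) <= #|D| + #|five|.
  have -> : \sum_(w in big) (deg w - 6) = \sum_(w in supp) (if w \in big then deg w - 6 else 0).
    rewrite -big_mkcondr; apply: eq_bigl => w; rewrite !inE.
    case: (ltnP 7 (deg w)) => lt7; rewrite ?andbF // andbT; apply/esym.
    by rewrite -card_gt0; apply: leq_trans lt7.
  have -> : #|five| = \sum_(w in supp) (w \in five).
    rewrite -sum1_card -big_mkcondr /=; apply: eq_bigl => w; rewrite !inE.
    case: eqP => w5; rewrite ?andbF // andbT; apply/esym.
    by rewrite -card_gt0 -/(deg w) w5.
  rewrite card_darts -big_split mulnC -sum_nat_const -big_split /=.
  apply: leq_sum => v /deg_ge5; rewrite !inE; case: (ltnP 7 (deg v)); case: eqP; clear; lia.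
by move: le0; rewrite cfive; have := card_five1; have := euler; clear; lia.
Qed.

End Discharging.

(** * Face boundaries of a minor of a grid *)

Import GRing.Theory.

Definition grid_adj (p q : nat * nat) : bool :=
  ((p.1 == q.1) && ((p.2 == q.2.+1) || (q.2 == p.2.+1))) ||
  ((p.2 == q.2) && ((p.1 == q.1.+1) || (q.1 == p.1.+1))).

(* The unit square [(i, j)] has upper right corner [(i, j)]; the two squares
   on the sides of a grid edge [pq] are [lface p q] and [rface p q]. *)
Definition lface (p q : nat * nat) := (maxn p.1 q.1, maxn p.2 q.2).
Definition rface (p q : nat * nat) :=
  if p.1 == q.1 then ((maxn p.1 q.1).+1, maxn p.2 q.2)
  else (maxn p.1 q.1, (maxn p.2 q.2).+1).

Lemma grid_adjC p q : grid_adj p q = grid_adj q p.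
Proof. rewrite /grid_adj; lia. Qed.

Lemma lfaceC p q : lface p q = lface q p.
Proof. by rewrite /lface maxnC (maxnC p.2). Qed.

Lemma rfaceC p q : rface p q = rface q p.
Proof. by rewrite /rface eq_sym maxnC (maxnC p.2). Qed.

(* Does the horizontal ray from the square [f] to the left cross the edge [pq]? *)
Definition crosses (p q f : nat * nat) : bool :=
  [&& p.1 == q.1, maxn p.2 q.2 == f.2 & p.1 < f.1].

Definition half_row (p q r : nat * nat) : bool :=
  [&& p.1 != q.1, r.2 == p.2 & r.1 <= minn p.1 q.1].

Definition same_edge (p q p' q' : nat * nat) : bool :=
  ((p == p') && (q == q')) || ((p == q') && (q == p')).

(* The last two terms depend on one end of [pq] each: they telescope along a path and
   cancel around a cycle. *)
Lemma crosses_coboundary p q p' q' : grid_adj p q -> grid_adj p' q' ->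
  crosses p q (lface p' q') (+) crosses p q (rface p' q') =
  same_edge p q p' q' (+) (half_row p' q' p (+) half_row p' q' q).
Proof.
case: p q p' q' => [x y] [z t] [x' y'] [z' t'].
rewrite /grid_adj /crosses /lface /rface /same_edge /half_row /= !xpair_eqE.
have maxSn n : maxn n.+1 n = n.+1 by apply/maxn_idPl.
have maxnS n : maxn n n.+1 = n.+1 by apply/maxn_idPr.
have minSn n : minn n.+1 n = n by apply/minn_idPr.
have minnS n : minn n n.+1 = n by apply/minn_idPl.
do 2![case/orP=> /andP[/eqP -> /orP[]/eqP ->] /=];
  rewrite ?maxSn ?maxnS ?maxnn ?minSn ?minnS ?eqxx ?(ltn_eqF (ltnSn _)) ?(gtn_eqF (ltnSn _)) ?andbF /=.
all: clear; lia.
Qed.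

Section CharacteristicTwo.
Local Open Scope ring_scope.

Lemma addFF (x : 'F_2) : x + x = 0.
Proof. by apply/eqP; case: x => [[|[|?]] ?]. Qed.

Lemma addbF2 (a b : bool) : (a (+) b)%:R = a%:R + b%:R :> 'F_2.
Proof. by case: a; case: b; rewrite ?addFF ?addr0 ?add0r. Qed.

Lemma sum_symmetric_F2 (I : finType) (f : I -> I -> 'F_2) :
  (forall i j, f i j = f j i) -> (forall i, f i i = 0) -> \sum_i \sum_j f i j = 0.
Proof.
move=> symf f0; pose lt (i j : I) := (enum_rank i < enum_rank j)%N.
have split i : \sum_j f i j = \sum_(j | lt i j) f i j + \sum_(j | lt j i) f i j.
  rewrite (bigID (lt i)) /=; congr (_ + _); rewrite (bigD1 i) /=; last by rewrite /lt ltnn.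
  rewrite f0 add0r; apply: eq_bigl => j; rewrite /lt -leqNgt ltn_neqAle andbC; congr (_ && _).
  by rewrite (inj_eq val_inj) (inj_eq enum_rank_inj).
rewrite (eq_bigr _ (fun i _ => split i)) big_split /=.
rewrite [X in _ + X](exchange_big_dep predT) //=.
rewrite [X in _ + X](_ : _ = \sum_i \sum_(j | lt i j) f i j) ?addFF //.
by apply: eq_bigr => i _; apply: eq_bigr => j _; apply: symf.
Qed.

End CharacteristicTwo.

Section GridMinor.
Local Open Scope ring_scope.
Variables (N : nat).
Implicit Types (p q r : 'I_N * 'I_N).

Definition coord p : nat * nat := (val p.1, val p.2).

Definition cell_adj p q := grid_adj (coord p) (coord q).
Definition grid_interior p := [&& 0 < p.1, p.1.+1 < N, 0 < p.2 & p.2.+1 < N]%N.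

Definition coboundary (a : nat * nat -> 'F_2) p q :=
  a (lface (coord p) (coord q)) + a (rface (coord p) (coord q)).

Lemma coord_inj : injective coord.
Proof. by move=> [? ?] [? ?] [] /val_inj -> /val_inj ->. Qed.

Lemma cell_adjC p q : cell_adj p q = cell_adj q p.
Proof. exact: grid_adjC. Qed.

Lemma cell_adj_irrefl p : cell_adj p p = false.
Proof. by rewrite /cell_adj /grid_adj; clear; lia. Qed.

Lemma coboundaryC a p q : coboundary a p q = coboundary a q p.
Proof. by rewrite /coboundary lfaceC rfaceC. Qed.

(** An interior point has four edges and four surrounding squares, and each square lies beside two
    of the edges. *)
Lemma coboundary_vertex a p : grid_interior p -> \sum_(q | cell_adj p q) coboundary a p q = 0.
Proof.
case: p => [[x ltx] [y lty]]; rewrite /grid_interior /= => /and4P[x0 xN y0 yN].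
have xm : (x.-1 < N)%N by rewrite (leq_ltn_trans (leq_pred x)).
have ym : (y.-1 < N)%N by rewrite (leq_ltn_trans (leq_pred y)).
pose p : 'I_N * 'I_N := (Ordinal ltx, Ordinal lty).
pose s : seq ('I_N * 'I_N) := [:: (Ordinal xN, Ordinal lty); (Ordinal xm, Ordinal lty);
  (Ordinal ltx, Ordinal yN); (Ordinal ltx, Ordinal ym)].
have us : uniq s.
  by rewrite /= !inE !xpair_eqE -!val_eqE /=; move: x0 y0; clear; lia.
rewrite (eq_bigl (mem s)) => [|[[z ltz] [t ltt]]]; last first.
  rewrite /cell_adj /grid_adj /= !inE !xpair_eqE -!val_eqE /=; move: x0 y0; clear; lia.
rewrite -big_uniq //= !big_cons big_nil /coboundary /lface /rface /=.
have -> : (x == x.+1) = false by move: x0; clear; lia.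
have -> : (x == x.-1) = false by move: x0; clear; lia.
rewrite eqxx !maxnn.
have -> : maxn x x.+1 = x.+1 by clear; lia.
have -> : maxn y y.+1 = y.+1 by clear; lia.
have -> : maxn x x.-1 = x by clear; lia.
have -> : maxn y y.-1 = y by clear; lia.
set a1 := a _; set a2 := a _; set a3 := a _; set a4 := a _.
have shuffle (R : comNzRingType) (b1 b2 b3 b4 : R) :
  b1 + b2 + (b3 + b4 + (b4 + b2 + (b3 + b1 + 0))) = (b1 + b1) + (b2 + b2) + (b3 + b3) + (b4 + b4).
  by ring.
by rewrite shuffle !addFF.
Qed.

Definition ray p q f : 'F_2 := (crosses (coord p) (coord q) f)%:R.
Definition hrow p q r : 'F_2 := (half_row (coord p) (coord q) (coord r))%:R.

Lemma ray_coboundary p q p' q' : cell_adj p q -> cell_adj p' q' ->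
  coboundary (ray p q) p' q' =
  (same_edge (coord p) (coord q) (coord p') (coord q'))%:R + (hrow p' q' p + hrow p' q' q).
Proof. by move=> pq pq'; rewrite /coboundary /ray -addbF2 crosses_coboundary // !addbF2. Qed.

(** The rays of the edges of the path are added up: the half-row terms of [crosses_coboundary]
    telescope to the two ends, and [same_edge] contributes only on edges of [r]. *)
Lemma path_coloring (r : rel ('I_N * 'I_N)) p q :
  (forall x y, r x y -> cell_adj x y) -> connect r p q ->
  exists a, forall p' q', cell_adj p' q' -> ~~ r p' q' -> ~~ r q' p' ->
    coboundary a p' q' = hrow p' q' p + hrow p' q' q.
Proof.
move=> radj /connectP[s]; elim: s p => [|x s IHs] p /=.
  move=> _ -> ; exists (fun _ => 0) => p' q' _ _ _.
  by rewrite /coboundary addr0 addFF.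
case/andP=> rpx /IHs IH /IH[a aP]; exists (fun f => ray p x f + a f) => p' q' adj n1 n2.
have -> : coboundary (fun f => ray p x f + a f) p' q' = coboundary (ray p x) p' q' + coboundary a p' q'.
  by rewrite /coboundary addrACA.
rewrite aP // ray_coboundary //; last exact: radj.
have -> : same_edge (coord p) (coord x) (coord p') (coord q') = false.
  rewrite /same_edge !(inj_eq coord_inj); apply/negP => /orP[] /andP[/eqP E1 /eqP E2].
    by move: n1; rewrite -E1 -E2 rpx.
  by move: n2; rewrite -E1 -E2 rpx.
by rewrite add0r addrA -(addrA (hrow _ _ p)) addFF addr0.
Qed.

End GridMinor.

Definition branch (T : eqType) N (beta : 'I_N * 'I_N -> option T) (u : T) : rel ('I_N * 'I_N) :=
  fun p q => [&& cell_adj p q, beta p == Some u & beta q == Some u].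

(* [e] is a minor of an [N x N] grid, with branch sets [beta^-1 (Some u)]. *)
Definition grid_minor (T : finType) (e : rel T) := exists N (beta : 'I_N * 'I_N -> option T),
  [/\ forall p, beta p != None -> grid_interior p,
      forall u p q, beta p = Some u -> beta q = Some u -> connect (branch beta u) p q &
      forall u w, e u w -> exists p q, [/\ cell_adj p q, beta p = Some u & beta q = Some w]].

(** * Cycles as coboundaries of face colorings *)

Section Dual.
Local Open Scope ring_scope.
Variables (T : finType) (e : rel T) (N : nat) (beta : 'I_N * 'I_N -> option T).
Variable pt : T -> T -> 'I_N * 'I_N.
Hypotheses (e_sym : symmetric e) (e_irr : irreflexive e).
Hypothesis beta_inner : forall p, beta p != None -> grid_interior p.
Hypothesis beta_connect : forall u p q, beta p = Some u -> beta q = Some u ->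
  connect (branch beta u) p q.
Hypothesis pt_adj : forall u w, e u w -> cell_adj (pt u w) (pt w u).
Hypothesis pt_beta : forall u w, e u w -> beta (pt u w) = Some u.
Implicit Types (u w : T) (p q : 'I_N * 'I_N) (a : nat * nat -> 'F_2).

Let inner p q := [exists u, branch beta u p q].
Let crossing p q := [exists d : T * T, [&& e d.1 d.2, p == pt d.1 d.2 & q == pt d.2 d.1]].

(* Colorings of the unit squares that are constant on the faces of the minor: they may
   change only across edges inside a branch set and across the chosen connecting edges. *)
Definition admissible a := forall p q, cell_adj p q -> ~~ inner p q -> ~~ crossing p q ->
  coboundary a p q = 0.

Let root u := pt u (odflt u [pick w | e u w]).

Let beta_root u w : e u w -> beta (root u) = Some u.
Proof. by rewrite /root; case: pickP => [w' /pt_beta //|/(_ w) ->]. Qed.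

Let pt_not_inner u w : e u w -> ~~ inner (pt u w) (pt w u).
Proof.
move=> euw; apply/existsP=> -[x /and3P[_ /eqP bx /eqP]]; rewrite -bx !pt_beta ?[e w u]e_sym //.
by case=> wu; rewrite wu e_irr in euw.
Qed.

Let innerC p q : inner p q = inner q p.
Proof. by apply: eq_existsb => u; rewrite /branch cell_adjC andbCA andbA andbC andbA andbC. Qed.

(** The path runs from [root u] over the connecting edge to [root w]. Its parts inside the two
    branch sets use inner edges only, so elsewhere just the connecting edge and the two roots are
    visible. *)
Lemma dart_coloring u w : e u w -> exists a, forall p q, cell_adj p q -> ~~ inner p q ->
  coboundary a p q = (same_edge (coord (pt u w)) (coord (pt w u)) (coord p) (coord q))%:R
    + (hrow p q (root u) + hrow p q (root w)).
Proof.
move=> euw; have ewu : e w u by rewrite e_sym.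
have tree x y : e x y -> exists a, forall p q, cell_adj p q -> ~~ inner p q ->
    coboundary a p q = hrow p q (pt x y) + hrow p q (root x).
  move=> exy; have conn := beta_connect (pt_beta exy) (beta_root exy).
  have [r1 r2 /and3P[]//|a aP] := path_coloring _ conn.
  exists a => p q adj nin; apply: aP => //.
    by apply: contra nin => b; apply/existsP; exists x.
  by rewrite innerC in nin; apply: contra nin => b; apply/existsP; exists x.
have [a aP] := tree u w euw; have [b bP] := tree w u ewu.
exists (fun f => ray (pt u w) (pt w u) f + (a f + b f)) => p q adj nin.
have -> : coboundary (fun f => ray (pt u w) (pt w u) f + (a f + b f)) p q =
   coboundary (ray (pt u w) (pt w u)) p q + (coboundary a p q + coboundary b p q).
  by rewrite /coboundary addrACA; congr (_ + _); rewrite addrACA.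
rewrite ray_coboundary ?pt_adj // aP // bP // -addrA; congr (_ + _).
by rewrite [X in _ + X]addrACA addrA addFF add0r.
Qed.

Lemma sum_delta (I : finType) (g : I -> 'F_2) x : \sum_i (x == i)%:R * g i = g x.
Proof.
rewrite (bigD1 x) //= eqxx mul1r big1 ?addr0 // => i; rewrite eq_sym => /negPf ->.
by rewrite mul0r.
Qed.

(** In the sum of the dart colorings weighted by [z], every root occurs with the degree of its
    vertex in [z] as coefficient, which vanishes. This is the algebraic substitute for telling the
    inside of a closed curve from its outside. *)
Lemma cycle_coloring (I : finType) (dd : I -> T * T) (z : I -> 'F_2) :
  (forall i, e (dd i).1 (dd i).2) ->
  (forall i j, dd i = dd j \/ dd i = ((dd j).2, (dd j).1) -> i = j) ->
  (forall u, \sum_i z i * (((dd i).1 == u)%:R + ((dd i).2 == u)%:R) = 0) ->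
  exists2 a, admissible a & forall i, coboundary a (pt (dd i).1 (dd i).2) (pt (dd i).2 (dd i).1) = z i.
Proof.
move=> e_dd dd_inj z_cycle.
have [B BP] := fin_all_exists (fun i => dart_coloring (e_dd i)).
pose a f := \sum_i z i * B i f.
have aE p q : cell_adj p q -> ~~ inner p q -> coboundary a p q = \sum_i z i *
    (same_edge (coord (pt (dd i).1 (dd i).2)) (coord (pt (dd i).2 (dd i).1)) (coord p) (coord q))%:R.
  move=> adj nin; rewrite /coboundary /a -big_split /=.
  under eq_bigr => i _ do rewrite -mulrDr -/(coboundary (B i) p q) BP // mulrDr.
  rewrite big_split /= [X in _ + X](_ : _ = 0) ?addr0 //.
  under eq_bigr => i _ do rewrite -(sum_delta (fun u => hrow p q (root u)) (dd i).1)
    -(sum_delta (fun u => hrow p q (root u)) (dd i).2) -big_split mulr_sumr /=.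
  rewrite exchange_big big1 //= => u _.
  rewrite (eq_bigr (fun i => hrow p q (root u) * (z i * (((dd i).1 == u)%:R + ((dd i).2 == u)%:R)))).
    by rewrite -mulr_sumr z_cycle mulr0.
  by move=> i _; ring.
exists a => [p q adj nin ncr|i].
  rewrite aE // big1 // => i _; rewrite (_ : same_edge _ _ _ _ = false) ?mulr0 //.
  apply: contraNF ncr; rewrite /same_edge !(inj_eq (@coord_inj N)) => /orP[] /andP[/eqP <- /eqP <-].
    by apply/existsP; exists (dd i); rewrite e_dd !eqxx.
  by apply/existsP; exists ((dd i).2, (dd i).1); rewrite /= e_sym e_dd !eqxx.
have e_i := e_dd i; rewrite aE ?pt_adj ?pt_not_inner // (bigD1 i) //=.
rewrite {1}/same_edge !eqxx mulr1 big1 ?addr0 // => j ji.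
rewrite (_ : same_edge _ _ _ _ = false) ?mulr0 //; apply: contraNF ji => same.
apply/eqP; apply: dd_inj.
have := e_dd j; rewrite (surjective_pairing (dd i)) (surjective_pairing (dd j)) /= => ej.
have bj1 := pt_beta ej; have bj2 : beta (pt (dd j).2 (dd j).1) = Some (dd j).2.
  by apply: pt_beta; rewrite e_sym.
have bi1 := pt_beta e_i; have bi2 : beta (pt (dd i).2 (dd i).1) = Some (dd i).2.
  by apply: pt_beta; rewrite e_sym.
move: same; rewrite /same_edge !(inj_eq (@coord_inj N)) => /orP[] /andP[/eqP E1 /eqP E2].
  by left; move: bj1 bj2; rewrite E1 E2 bi1 bi2 => -[->] [->].
by right; move: bj1 bj2; rewrite E1 E2 bi1 bi2 => -[->] [->].
Qed.

(** [coboundary_vertex] is summed over the branch set of [u]: edges inside it are counted twice and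
    cancel, and of the edges leaving it only the chosen connecting ones contribute. *)
Lemma admissible_vertex a u : admissible a ->
  \sum_(w | e u w) coboundary a (pt u w) (pt w u) = 0.
Proof.
move=> adm; pose B p := beta p == Some u.
have all0 : \sum_(p | B p) \sum_(q | cell_adj p q) coboundary a p q = 0.
  rewrite big1 // => p /eqP bp; apply: coboundary_vertex; apply: beta_inner.
  by rewrite bp.
have in0 : \sum_(p | B p) \sum_(q | cell_adj p q && B q) coboundary a p q = 0.
  rewrite big_mkcond -[RHS](sum_symmetric_F2
    (f := fun p q => if [&& B p, B q & cell_adj p q] then coboundary a p q else 0)).
  - apply: eq_bigr => p _; case: (B p) => /=; last by rewrite big1.
    by rewrite big_mkcond; apply: eq_bigr => q _; rewrite andbC.
  - by move=> p q; rewrite coboundaryC cell_adjC andbCA.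
  - by move=> p; rewrite cell_adj_irrefl !andbF.
have: \sum_(p | B p) \sum_(q | cell_adj p q && ~~ B q) coboundary a p q = 0.
  rewrite -[RHS]all0 -[LHS]add0r -{1}in0 -big_split /=.
  by apply: eq_bigr => p _; rewrite [RHS](bigID B).
rewrite pair_big_dep /= => out0; rewrite -[RHS]out0.
pose f w := (pt u w, pt w u).
have f_inj : {in [pred w | e u w] &, injective f}.
  move=> w w' /= euw euw' [_ E2]; apply: Some_inj.
  rewrite -(pt_beta (u := w) (w := u)) ?(e_sym w) // E2 pt_beta // e_sym //.
transitivity (\sum_(d in f @: [pred w | e u w]) coboundary a d.1 d.2).
  by rewrite (big_imset _ f_inj).
rewrite big_mkcond [RHS]big_mkcond; apply: eq_bigr => -[p q] _ /=.
case: imsetP => [[w /= euw [-> ->]]|nim].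
  rewrite /B pt_beta // pt_adj // pt_beta ?(e_sym w) // eqxx /=.
  by rewrite (inj_eq Some_inj); case: eqP => // wu; rewrite inE wu e_irr in euw.
case: ifP => // /and3P[/eqP bp adj bq]; apply/esym; apply: adm => //.
  apply/existsP=> -[x /and3P[_ /eqP bp' bq']].
  by move: bq; rewrite /B -bp bp' bq'.
apply/existsP=> -[[x w] /= /and3P[exw /eqP pE /eqP qE]]; apply: nim.
have xu : x = u by apply: Some_inj; rewrite -bp pE pt_beta.
by exists w; rewrite ?inE -?xu // /f pE qE -?xu.
Qed.

(** Faces are defined by duality, as classes of squares that no admissible coloring tells apart,
    instead of by connecting squares. The indicator of a class is again admissible, see
    [same_face_admissible]. *)
Let same_face f g := `[< forall a, admissible a -> a f = a g >].
Let lf (d : T * T) := lface (coord (pt d.1 d.2)) (coord (pt d.2 d.1)).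
Let rf (d : T * T) := rface (coord (pt d.1 d.2)) (coord (pt d.2 d.1)).

Let same_face_refl f : same_face f f.
Proof. exact/asboolP. Qed.

Let same_face_eq f g : same_face f g -> same_face f =1 same_face g.
Proof.
move=> /asboolP fg h; apply/asboolP/asboolP => H a adm; first by rewrite -fg // H.
by rewrite fg // H.
Qed.

Let same_face_sym f g : same_face f g = same_face g f.
Proof. by apply/asboolP/asboolP => H a adm; rewrite H. Qed.

Let same_face_admissible f : admissible (fun g => (same_face f g)%:R).
Proof.
move=> p q adj nin ncr; rewrite /coboundary.
set g := lface _ _; set h := rface _ _; suff gh : same_face g h.
  by rewrite !(same_face_sym f) (same_face_eq gh) addFF.
apply/asboolP=> a adm; apply: (addIr (a h)); rewrite addFF; exact: adm.
Qed.

Definition boundary f : {set T * T} :=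
  [set d | e d.1 d.2 && (same_face f (lf d) (+) same_face f (rf d))].

Lemma boundary_even f : even_subgraph e (boundary f).
Proof.
split=> [|x y|x].
- by apply/subsetP=> d; rewrite !inE => /andP[].
- by rewrite !inE /lf /rf /= lfaceC rfaceC e_sym.
have := admissible_vertex x (same_face_admissible f).
rewrite -[X in X = _](_ : (#|[set y | (x, y) \in boundary f]|)%:R = _).
  move=> /eqP; rewrite -(dvdn_pcharf (pchar_Fp (isT : prime 2))) dvdn2 //.
rewrite -sum1_card natr_sum big_mkcond [RHS]big_mkcond; apply: eq_bigr => y _.
rewrite !inE /coboundary -addbF2 /lf /rf /=; case: (e x y) => //=.
by case: (_ (+) _).
Qed.

Definition minor_faces := [set S | (S != set0) &&
  [exists d, e d.1 d.2 && ((S == boundary (lf d)) || (S == boundary (rf d)))]].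

Let boundary_eq f g : same_face f g -> boundary f = boundary g.
Proof. by move=> fg; apply/setP=> d; rewrite !inE !(same_face_eq fg). Qed.

Lemma minor_faces_even S : S \in minor_faces -> even_subgraph e S.
Proof.
by rewrite inE => /andP[_ /existsP[d /andP[_ /orP[] /eqP ->]]]; apply: boundary_even.
Qed.

Lemma minor_faces_neq0 : set0 \notin minor_faces.
Proof. by rewrite inE eqxx. Qed.

Lemma minor_faces_le2 d : (#|[set S in minor_faces | d \in S]| <= 2)%N.
Proof.
apply: leq_trans (_ : #|[set boundary (lf d); boundary (rf d)]| <= 2)%N; last first.
  by rewrite cards2; case: eqP.
have inb f : d \in boundary f -> boundary f \in [set boundary (lf d); boundary (rf d)].
  rewrite !inE => /andP[_].
  have [fl _|_] := boolP (same_face f (lf d)); first by rewrite (boundary_eq fl) eqxx.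
  by move=> fr; rewrite (boundary_eq fr) eqxx orbT.
apply: subset_leq_card; apply/subsetP=> S.
by rewrite inE inE => /andP[/andP[_ /existsP[d' /andP[_ /orP[]/eqP->]]] /inb].
Qed.

Let supp := [set v | nb e v != set0].
Let Eo := [set d | e d.1 d.2 & (enum_rank d.1 < enum_rank d.2)%N].
Let dd (i : 'I_#|Eo|) : T * T := enum_val i.

Let dd_edge i : e (dd i).1 (dd i).2.
Proof. by have := enum_valP i; rewrite inE => /andP[]. Qed.

Let dd_inj i j : dd i = dd j \/ dd i = ((dd j).2, (dd j).1) -> i = j.
Proof.
case=> [/enum_val_inj //|Eij]; have := enum_valP i; have := enum_valP j.
rewrite !inE -/(dd i) -/(dd j) => /andP[_ lt1] /andP[_ lt2].
by rewrite Eij /= ltnNge (ltnW lt1) in lt2.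
Qed.

Let card_darts_oriented : #|darts e| = (2 * #|Eo|)%N.
Proof.
have inj : injective (fun d : T * T => (d.2, d.1)) by move=> [? ?] [? ?] [-> ->].
rewrite mul2n -addnn -{2}(card_imset _ inj) -cardsUI.
rewrite [X in (_ + X)%N](_ : _ = 0%N) ?addn0; last first.
  apply: eq_card0 => d; rewrite !inE; apply/negP => /andP[/andP[_ lt1] /imsetP[c]].
  by rewrite inE => /andP[_ lt2] dE; move: lt1; rewrite dE /= ltnNge (ltnW lt2).
apply: eq_card => d; rewrite !inE; apply/idP/idP => [ed|].
  case: (ltngtP (enum_rank d.1) (enum_rank d.2)) => [lt|lt|]; first by rewrite ed.
    by apply/orP; right; apply/imsetP; exists (d.2, d.1); rewrite ?inE /= ?(e_sym d.2) ?ed //; case: (d).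
  by move=> /val_inj /enum_rank_inj eqd; rewrite eqd e_irr in ed.
case/orP=> [/andP[]//|/imsetP[c]]; rewrite inE => /andP[ec _] ->.
by rewrite /= e_sym.
Qed.

Let incidence : 'M['F_2]_(#|Eo|, #|supp|) :=
  \matrix_(i, x) (((dd i).1 == enum_val x)%:R + ((dd i).2 == enum_val x)%:R).

Let row_boundary f : 'rV['F_2]_#|Eo| := \row_i (dd i \in boundary f)%:R.

Let face_matrix : 'M['F_2]_(#|minor_faces|, #|Eo|) :=
  \matrix_(k < #|minor_faces|, i < #|Eo|) (dd i \in (enum_val k : {set T * T}))%:R.

Let row_boundary_sub f d : e d.1 d.2 -> f \in [:: lf d; rf d] ->
  (row_boundary f <= face_matrix)%MS.
Proof.
move=> ed fd; have [b0|bn0] := eqVneq (boundary f) set0.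
  by rewrite (_ : row_boundary f = 0) ?sub0mx //; apply/rowP=> i; rewrite !mxE b0 inE.
have bF : boundary f \in minor_faces.
  rewrite inE bn0; apply/existsP; exists d; rewrite ed.
  by move: fd; rewrite !inE => /orP[]/eqP <-; rewrite eqxx ?orbT.
rewrite (_ : row_boundary f = row (enum_rank_in bF (boundary f)) face_matrix) ?row_sub //.
by apply/rowP=> i; rewrite !mxE enum_rankK_in.
Qed.

(** A cycle is the coboundary of an admissible [a]. Being constant on faces, [a] is a combination of
    face indicators, and [rep] selects one square per face so that each is used once; coboundaries
    turn the indicators into face boundaries. *)
Let cycle_sub (z : 'rV_#|Eo|) : z *m incidence = 0 -> (z <= face_matrix)%MS.
Proof.
move=> z0; have [|a adm aE] := cycle_coloring (z := fun i => z 0 i) dd_edge dd_inj.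
  move=> u; have [us|nus] := boolP (u \in supp).
    move/rowP/(_ (enum_rank_in us u)): z0; rewrite !mxE => z0u; rewrite -[RHS]z0u; apply: eq_bigr => i _.
    by rewrite mxE enum_rankK_in.
  rewrite big1 // => i _; have ei := dd_edge i.
  have nu x y : e x y -> (x == u) = false.
    move=> exy; apply: contraNF nus => /eqP <-; rewrite inE; apply/set0Pn; exists y.
    by rewrite inE.
  by rewrite (nu _ _ ei) (nu (dd i).2 (dd i).1) 1?e_sym // addr0 mulr0.
pose side (j : 'I_#|Eo| * bool) := if j.2 then lf (dd j.1) else rf (dd j.1).
pose rep j := odflt j [pick j' | same_face (side j) (side j')].
have repP j : same_face (side j) (side (rep j)).
  by rewrite /rep; case: pickP => [//|/(_ j)]; rewrite same_face_refl.
have rep_eq j j' : same_face (side j) (side j') -> rep j = rep j'.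
  move=> jj'; rewrite /rep (eq_pick (fun x => same_face_eq jj' (side x))).
  by case: pickP => // /(_ j'); rewrite same_face_refl.
have -> : z = \sum_(j | rep j == j) a (side j) *: row_boundary (side j).
  apply/rowP=> i; rewrite -aE summxE /coboundary -/(lf (dd i)) -/(rf (dd i)).
  have sum_rep j : \sum_(j' | rep j' == j') a (side j') * (same_face (side j') (side j))%:R = a (side j).
    rewrite (bigD1 (rep j)) /=; last by apply/eqP/esym/rep_eq.
    rewrite same_face_sym repP mulr1 big1 ?addr0.
      by have /asboolP/(_ a adm) := repP j.
    move=> j' /andP[/eqP j'rep j'j]; case: (boolP (same_face _ _)) => [jj'|_]; last by rewrite mulr0.
    by rewrite -j'rep (rep_eq _ _ jj') eqxx in j'j.
  transitivity (\sum_(j | rep j == j) a (side j) * (same_face (side j) (side (i, true)))%:R +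
                \sum_(j | rep j == j) a (side j) * (same_face (side j) (side (i, false)))%:R).
    by rewrite !sum_rep.
  rewrite -big_split; apply: eq_bigr => j _ /=.
  by rewrite !mxE inE dd_edge /= -mulrDr -addbF2.
apply: summx_sub => j _; apply: scalemx_sub.
by apply: (row_boundary_sub (dd_edge j.1)); rewrite /side; case: (j.2); rewrite !inE eqxx ?orbT.
Qed.

(** The columns of [incidence] sum to zero, so its rank is less than [#|supp|], while its left
    kernel is spanned by face boundaries. The inequality is one weaker than Euler's formula but
    attained by a single cycle, whose two sides share their boundary; the total charge is still
    negative. *)
Lemma minor_euler : supp != set0 -> (#|darts e| + 2 <= 2 * #|minor_faces| + 2 * #|supp|)%N.
Proof.
move=> supp0; have s0 : (0 < #|supp|)%N by rewrite card_gt0.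
have ones : incidence *m (const_mx 1 : 'cV_#|supp|) = 0.
  apply/colP=> i; rewrite !mxE; under eq_bigr => x _ do rewrite !mxE mulr1.
  have hit u w : e u w -> \sum_(x < #|supp|) (u == enum_val x)%:R = 1 :> 'F_2.
    move=> euw; have us : u \in supp by rewrite inE; apply/set0Pn; exists w; rewrite inE.
    rewrite (bigD1 (enum_rank_in us u)) //= enum_rankK_in // eqxx big1 ?addr0 // => x.
    case: (u =P enum_val x) => // ux /eqP[]; apply: enum_val_inj.
    by rewrite enum_rankK_in.
  by rewrite big_split /= (hit _ _ (dd_edge i)) (hit (dd i).2 (dd i).1) ?addFF // e_sym.
have rank1 : (0 < \rank (const_mx 1%R : 'cV['F_2]_#|supp|))%N.
  rewrite lt0n mxrank_eq0; apply/negP => /eqP/colP/(_ (Ordinal s0)); rewrite !mxE.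
  by move/eqP; rewrite oner_eq0.
have rank_inc := mulmx0_rank_max ones.
have rank_ker : (\rank (kermx incidence) <= #|minor_faces|)%N.
  apply: leq_trans (rank_leq_row face_matrix); apply: mxrankS; apply/row_subP=> i.
  by apply: cycle_sub; apply/sub_kermxP; apply: row_sub.
rewrite mxrank_ker in rank_ker; rewrite card_darts_oriented.
by move: rank_ker rank_inc rank1 (rank_leq_row incidence); clear; lia.
Qed.

End Dual.

(** * Closure of grid minors and the induction *)

Section GridMinorTheory.
Local Open Scope ring_scope.
Variable T : finType.
Implicit Types (e : rel T) (u v w : T) (S : {set T}).

Definition support e := [set v | nb e v != set0].

Lemma in_support e u w : e u w -> u \in support e.
Proof. by move=> euw; rewrite inE; apply/set0Pn; exists w; rewrite inE. Qed.

Lemma grid_minor_faces e : symmetric e -> irreflexive e -> grid_minor e -> support e != set0 ->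
  exists FF : {set {set T * T}}, [/\ forall F, F \in FF -> even_subgraph e F, set0 \notin FF,
    forall d, (#|[set F in FF | d \in F]| <= 2)%N &
    (#|darts e| + 2 <= 2 * #|FF| + 2 * #|support e|)%N].
Proof.
move=> e_sym e_irr [N [beta [beta_int beta_conn beta_adj]]] supp0.
have [p0 _] : exists p0 : 'I_N * 'I_N, true.
  case/set0Pn: (supp0) => u; rewrite inE => /set0Pn[w]; rewrite inE => /beta_adj[p _].
  by exists p.
have [f fP] : exists f : T * T -> ('I_N * 'I_N) * ('I_N * 'I_N), forall d, e d.1 d.2 ->
    [/\ cell_adj (f d).1 (f d).2, beta (f d).1 = Some d.1 & beta (f d).2 = Some d.2].
  apply: (@fin_all_exists _ (fun=> _) (fun d pq => e d.1 d.2 ->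
    [/\ cell_adj pq.1 pq.2, beta pq.1 = Some d.1 & beta pq.2 = Some d.2])) => d.
  have [/beta_adj[p [q ?]]|_] := boolP (e d.1 d.2); first by exists (p, q).
  by exists (p0, p0).
pose pt u w := if (enum_rank u < enum_rank w)%N then (f (u, w)).1 else (f (w, u)).2.
have rank_neq u w : e u w -> enum_rank u != enum_rank w :> nat.
  by apply: contraTneq => /val_inj /enum_rank_inj ->; rewrite e_irr.
have pt_beta u w : e u w -> beta (pt u w) = Some u.
  rewrite /pt => euw; case: ifP => _; first by have [] := fP (u, w) euw.
  by rewrite e_sym in euw; have [] := fP (w, u) euw.
have pt_adj u w : e u w -> cell_adj (pt u w) (pt w u).
  move=> euw; have ewu : e w u by rewrite e_sym.
  have := rank_neq u w euw; rewrite /pt; case: ltngtP => // _ _.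
    by have [] := fP (u, w) euw.
  by rewrite cell_adjC; have [] := fP (w, u) ewu.
exists (minor_faces e beta pt); split.
- exact: minor_faces_even.
- exact: minor_faces_neq0.
- exact: minor_faces_le2.
- exact: minor_euler.
Qed.

Lemma grid_minor_sub e e' : subrel e' e -> grid_minor e -> grid_minor e'.
Proof.
move=> sub [N [beta [H1 H2 H3]]]; exists N, beta; split=> // u w /sub; exact: H3.
Qed.

(** The branch set of [w] absorbs that of [v] and stays connected through a grid edge between them.
    This simplicity is a reason to run the induction over grid minors and not over drawings. *)
Lemma grid_minor_contract e v w : symmetric e -> e v w -> grid_minor e -> grid_minor (contract e v w).
Proof.
move=> e_sym evw [N [beta [beta_int beta_conn beta_adj]]].
pose beta' p := if beta p == Some v then Some w else beta p.
have adjC x y : (exists p q, [/\ cell_adj p q, beta' p = Some x & beta' q = Some y]) ->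
    exists p q, [/\ cell_adj p q, beta' p = Some y & beta' q = Some x].
  by case=> p [q [pq px qy]]; exists q, p; rewrite cell_adjC.
have beta'E p x : x != v -> beta p = Some x -> beta' p = Some x.
  by rewrite /beta' => xv ->; rewrite (inj_eq Some_inj) (negPf xv).
exists N, beta'; split=> [p|u p q pu qu|x y].
- by move=> bp; apply: beta_int; move: bp; rewrite /beta'; case: (beta p =P Some v) => // ->.
- have lift x : (forall r, beta r = Some x -> beta' r = Some u) ->
      subrel (connect (branch beta x)) (connect (branch beta' u)).
    move=> xu; apply: connect_sub => r s /and3P[adj /eqP rx /eqP sx].
    by apply: connect1; rewrite /branch adj (xu r) // (xu s) // eqxx.
  have [uw|uw] := eqVneq u w; last first.
    have notv r : beta' r = Some u -> beta r = Some u.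
      by rewrite /beta'; case: eqP => // _ [] wu; rewrite wu eqxx in uw.
    apply: (lift u); last by apply: beta_conn; apply: notv.
    move=> r ru; apply: beta'E => //; apply/eqP => uv; subst u.
    by move: pu; rewrite /beta'; case: (beta p =P Some v) => // _ [] /eqP; rewrite eq_sym (negPf uw).
  subst u; have [a [b [ab av bw]]] := beta_adj v w evw.
  have lv : forall r, beta r = Some v -> beta' r = Some w by move=> r rv; rewrite /beta' rv eqxx.
  have lw : forall r, beta r = Some w -> beta' r = Some w.
    by move=> r rw; rewrite /beta' rw; case: ifP.
  have ab' : connect (branch beta' w) a b by apply: connect1; rewrite /branch ab lv // lw // eqxx.
  have branch_sym : connect_sym (branch beta' w).
    by apply: sym_connect_sym => r s; rewrite /branch cell_adjC [X in _ && X]andbC.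
  have to_b r : beta' r = Some w -> connect (branch beta' w) r b.
    move=> rw; have [rv|rv] := eqVneq (beta r) (Some v).
      by apply: connect_trans ab'; apply: (lift v lv); apply: beta_conn.
    apply: (lift w lw); apply: beta_conn => //.
    by move: rw; rewrite /beta' (negPf rv).
  by apply: connect_trans (to_b p pu) _; rewrite branch_sym to_b.
case/and4P=> xv yv xy /or3P[exy|/andP[/eqP -> evy]|/andP[/eqP -> evx]].
- have [p [q [pq px qy]]] := beta_adj x y exy; exists p, q; split=> //; exact: beta'E.
- have [p [q [pq pv qy]]] := beta_adj v y evy; exists p, q; split=> //; last exact: beta'E.
  by rewrite /beta' pv eqxx.
apply: adjC; have [p [q [pq pv qx]]] := beta_adj v x evx; exists p, q; split=> //; last exact: beta'E.
by rewrite /beta' pv eqxx.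
Qed.

Lemma delete_symmetric e S : symmetric e -> symmetric (delete e S).
Proof. by move=> e_sym x y; rewrite /delete e_sym andbCA. Qed.

Lemma delete_irreflexive e S : irreflexive e -> irreflexive (delete e S).
Proof. by move=> e_irr x; rewrite /delete e_irr !andbF. Qed.

Lemma contract_symmetric e v w : symmetric e -> symmetric (contract e v w).
Proof.
by move=> e_sym x y; rewrite /contract e_sym andbCA (eq_sym x y) [X in _ || X]orbC.
Qed.

Lemma contract_irreflexive e v w : irreflexive (contract e v w).
Proof. by move=> x; rewrite /contract eqxx /= !andbF. Qed.

Lemma support_delete e S v : v \in support e -> v \in S ->
  (#|support (delete e S)| < #|support e|)%N.
Proof.
move=> vs vS; apply: proper_card; apply/properP; split.
  apply/subsetP=> x; rewrite inE => /set0Pn[y]; rewrite inE => /and3P[_ _].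
  exact: in_support.
exists v => //; rewrite inE negbK; apply/eqP/setP=> y.
by rewrite !inE /delete vS.
Qed.

Lemma support_contract e v w : symmetric e -> e v w ->
  (#|support (contract e v w)| < #|support e|)%N.
Proof.
move=> e_sym evw; apply: proper_card; apply/properP; split.
  apply/subsetP=> x; rewrite inE => /set0Pn[y]; rewrite inE.
  case/and4P=> _ _ _ /or3P[/in_support //|/andP[/eqP -> _]|/andP[_]].
    by rewrite e_sym in evw; exact: in_support evw.
  by rewrite e_sym => /in_support.
exists v; first exact: in_support evw.
rewrite inE negbK; apply/eqP/setP=> y.
by rewrite !inE /contract eqxx.
Qed.

Theorem grid_minor_colorable e : symmetric e -> irreflexive e -> grid_minor e -> colorable e.
Proof.
have [n] := ubnP #|support e|; elim: n e => // n IHn e /ltnSE le_n e_sym e_irr e_minor.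
have IHdel S v : v \in support e -> v \in S -> colorable (delete e S).
  move=> vs vS; apply: IHn.
  - exact: leq_trans (support_delete vs vS) le_n.
  - exact: delete_symmetric.
  - exact: delete_irreflexive.
  - by apply: grid_minor_sub e_minor => x y /and3P[].
have [//|ncol] := pselect (colorable e); exfalso.
have supp0 : support e != set0.
  apply/eqP => s0; apply: ncol; exists (fun=> ord0).
  have nb0 x : nb e x = set0.
    by apply/eqP; move/setP/(_ x): s0; rewrite !inE => /negbFE.
  split=> [x y exy|x]; last by rewrite nb0 eqxx.
  by move/setP/(_ y): (nb0 x); rewrite !inE exy.
have deg_supp v k : #|nb e v| = k.+1 -> v \in support e.
  by move=> dv; rewrite inE -card_gt0 dv.
have [FF [FF_even FF0 FF2 euler]] := grid_minor_faces e_sym e_irr e_minor supp0.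
apply: (discharging e_sym e_irr FF_even FF0 FF2 euler).
- move=> v; rewrite inE => /set0Pn[w]; rewrite inE => evw; rewrite ltnNge; apply/negP => d4.
  apply: ncol; apply: (reduce_contract e_sym e_irr evw d4); apply: IHn.
  + exact: leq_trans (support_contract e_sym evw) le_n.
  + exact: contract_symmetric.
  + exact: contract_irreflexive.
  + exact: grid_minor_contract.
- move=> v d5; rewrite leqNgt; apply/negP => two; apply: ncol.
  apply: (reduce_five_odd e_sym e_irr d5 two).
  exact: IHdel (deg_supp v 4 d5) (set11 v).
- move=> u v x y du dv euv xy eux evx euy evy; apply: ncol.
  apply: (reduce_five_five e_sym e_irr du dv euv xy eux evx euy evy).
  by apply: IHdel (deg_supp u 4 du) _; rewrite !inE eqxx.
move=> v u w x y dv du dw evu evw euw xy xw yu evx eux evy ewy; apply: ncol.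
apply: (reduce_five_six_six e_sym e_irr dv du dw evu evw euw xy xw yu evx eux evy ewy).
by apply: IHdel (deg_supp v 4 dv) _; rewrite !inE eqxx.
Qed.

End GridMinorTheory.

(** * Plane drawings are minors of grids *)

Section GridPaths.
Variable N : nat.
Implicit Types (c q r : 'I_N * 'I_N) (U : pred ('I_N * 'I_N)).

Definition within_grid U : rel ('I_N * 'I_N) := fun c q => [&& cell_adj c q, U c & U q].

Lemma within_grid_sym U : connect_sym (within_grid U).
Proof.
by apply: sym_connect_sym => c q; rewrite /within_grid cell_adjC [X in _ && X]andbC.
Qed.

Lemma within_grid_sub U U' : subpred U U' ->
  subrel (connect (within_grid U)) (connect (within_grid U')).
Proof.
move=> sUU'; apply: connect_sub => c q /and3P[adj /sUU' c' /sUU' q'].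
by apply: connect1; rewrite /within_grid adj c' q'.
Qed.

Lemma connect_last U c q : U c -> connect (within_grid U) c q -> U q.
Proof.
move=> Uc /connectP[s]; elim: s c Uc => [|r s IHs] c Uc /=; first by move=> _ ->.
by case/andP=> /and3P[_ _ Ur]; exact: IHs.
Qed.

(** All intermediate points of a path are reachable too. So a set defined by reachability is
    connected in itself, as a branch set must be. *)
Lemma connect_component U c q : connect (within_grid U) c q ->
  connect (within_grid (connect (within_grid U) c)) c q.
Proof.
case/connectP=> s; elim/last_ind: s q => [|s r IHs] q /=; first by move=> _ ->.
rewrite rcons_path last_rcons => /andP[ps rel_r] ->.
have cs : connect (within_grid U) c (last c s) by apply/connectP; exists s.
apply: connect_trans (IHs _ ps erefl) _; apply: connect1; rewrite /within_grid cs.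
by rewrite (connect_trans cs (connect1 rel_r)); case/and3P: rel_r => ->.
Qed.

Lemma connect_exit (r : rel ('I_N * 'I_N)) U c q : connect r c q -> U c -> ~~ U q ->
  exists c' q', [/\ r c' q', U c' & ~~ U q'].
Proof.
case/connectP=> s; elim: s c => [|x s IHs] c /=; first by move=> _ -> ->.
case/andP=> rcx ps lq Uc nUq; have [Ux|nUx] := boolP (U x); first exact: IHs ps lq Ux nUq.
by exists c, x.
Qed.

Definition between c q r :=
  [&& minn c.1 q.1 <= r.1, r.1 <= maxn c.1 q.1, minn c.2 q.2 <= r.2 & r.2 <= maxn c.2 q.2]%N.

Lemma connect_box U c q : (forall r, between c q r -> U r) -> connect (within_grid U) c q.
Proof.
have [n] := ubnP ((c.1 - q.1) + (q.1 - c.1) + ((c.2 - q.2) + (q.2 - c.2)))%N.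
elim: n c => // n IHn c /ltnSE le_n Ubox.
have step c' : cell_adj c c' -> between c q c' -> (forall r, between c' q r -> between c q r) ->
    ((c'.1 - q.1) + (q.1 - c'.1) + ((c'.2 - q.2) + (q.2 - c'.2)) < n)%N ->
    connect (within_grid U) c q.
  move=> adj cqc' sub lt_n; apply: connect_trans (connect1 _) (IHn c' lt_n _).
    by rewrite /within_grid adj !Ubox // /between; move: adj; clear; lia.
  by move=> r /sub /Ubox.
case: c le_n Ubox step => [[x ltx] [y lty]]; case: q IHn => [[z ltz] [t ltt]] IHn /=.
rewrite /between /= => le_n Ubox step.
have [xz|zx|xz] := ltngtP x z.
- have lt : (x.+1 < N)%N by have := ltz; have := xz; clear; lia.
  apply: (step (Ordinal lt, Ordinal lty)); rewrite /cell_adj /grid_adj /=.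
  + by clear; lia.
  + by have := xz; clear; lia.
  + by move=> r; have := xz; clear; lia.
  by have := le_n; have := xz; clear; lia.
- have lt : (x.-1 < N)%N by have := ltx; clear; lia.
  apply: (step (Ordinal lt, Ordinal lty)); rewrite /cell_adj /grid_adj /=.
  + by have := zx; clear; lia.
  + by have := zx; clear; lia.
  + by move=> r; have := zx; clear; lia.
  by have := le_n; have := zx; clear; lia.
have [yt|ty|yt] := ltngtP y t.
- have lt : (y.+1 < N)%N by have := ltt; have := yt; clear; lia.
  apply: (step (Ordinal ltx, Ordinal lt)); rewrite /cell_adj /grid_adj /=.
  + by clear; lia.
  + by have := yt; clear; lia.
  + by move=> r; have := yt; clear; lia.
  by have := le_n; have := yt; clear; lia.
- have lt : (y.-1 < N)%N by have := lty; clear; lia.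
  apply: (step (Ordinal ltx, Ordinal lt)); rewrite /cell_adj /grid_adj /=.
  + by have := ty; clear; lia.
  + by have := ty; clear; lia.
  + by move=> r; have := ty; clear; lia.
  by have := le_n; have := ty; clear; lia.
rewrite (_ : (Ordinal ltx, Ordinal lty) = (Ordinal ltz, Ordinal ltt)) ?connect0 //.
by congr (_, _); apply: val_inj.
Qed.

End GridPaths.

Require Import Defs.
From mathcomp Require Import all_classical all_reals all_analysis.
Import Order.TTheory Num.Theory.
Import numFieldNormedType.Exports.

(** * Compactness estimates for plane curves *)

Section PlaneCurves.
Local Open Scope classical_set_scope.
Local Open Scope ring_scope.
Variable R : realType.
Implicit Types (p q : plane R) (g k : R -> plane R) (r e s t : R).

Lemma cvg_max (T : topologicalType) (f k : T -> R) x :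
  f @ x --> f x -> k @ x --> k x -> Num.max (f y) (k y) @[y --> x] --> Num.max (f x) (k x).
Proof. by move=> cf ck; exact: (@continuous_max R T f k x cf ck). Qed.

(** Composing with [clamp] extends a curve constantly beyond its ends, so continuity within an
    interval becomes continuity on the line. *)
Definition clamp (t : R) : R := Num.max 0 (Num.min 1 t).

Lemma in01 (t : R) : `[0, 1]%classic t = (0 <= t <= 1) :> Prop.
Proof. by rewrite /= in_itv. Qed.

Lemma clamp_itv t : 0 <= clamp t <= 1.
Proof. by rewrite /clamp le_max lexx /= ge_max ler01 ge_min lexx. Qed.

Lemma clampE t : 0 <= t <= 1 -> clamp t = t.
Proof.
case/andP=> t0 t1; by rewrite /clamp min_r // max_r.
Qed.

Lemma clamp_continuous : continuous clamp.
Proof.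
move=> t; apply: continuous_max; first exact: cst_continuous.
by apply: continuous_min; [exact: cst_continuous | exact: cvg_id].
Qed.

Lemma continuous_clamp g : {within `[0, 1], continuous g} -> continuous (g \o clamp).
Proof.
move=> /subspace_continuousP cg t; have ct : `[0, 1]%classic (clamp t) by rewrite in01 clamp_itv.
apply: cvg_comp (cg _ ct).
move=> A /clamp_continuous nA.
apply: (@filterS _ (nbhs t) _ _ (clamp @^-1` A) _ nA) => s As.
by apply: As; rewrite /= in_itv /= clamp_itv.
Qed.

(** The maximum distance: its balls are squares, so the grid points near a given point form a
    rectangle, to which [connect_box] applies. *)
Definition pdist p q : R := Num.max `|p.1 - q.1| `|p.2 - q.2|.

Lemma pdist_le p q d : (pdist p q <= d) = (`|p.1 - q.1| <= d) && (`|p.2 - q.2| <= d).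
Proof. by rewrite /pdist ge_max. Qed.

Lemma pdist_ge0 p q : 0 <= pdist p q.
Proof. by rewrite /pdist le_max normr_ge0. Qed.

Lemma pdist_gt0 p q : (0 < pdist p q) = (p != q).
Proof.
rewrite /pdist lt_max !normr_gt0 !subr_eq0; case: p q => [x y] [z t] /=.
by rewrite xpair_eqE negb_and.
Qed.

Lemma pdist_continuous (T : topologicalType) (f g : T -> plane R) :
  continuous f -> continuous g -> continuous (fun x => pdist (f x) (g x)).
Proof.
move=> cf cg x; have [c1 c2] : ((fun y => (f y).1) @ x --> (f x).1) /\ ((fun y => (f y).2) @ x --> (f x).2).
  by split; [apply: cvg_comp (cf x) _; exact: cvg_fst | apply: cvg_comp (cf x) _; exact: cvg_snd].
have [d1 d2] : ((fun y => (g y).1) @ x --> (g x).1) /\ ((fun y => (g y).2) @ x --> (g x).2).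
  by split; [apply: cvg_comp (cg x) _; exact: cvg_fst | apply: cvg_comp (cg x) _; exact: cvg_snd].
by apply: cvg_max; apply: cvg_norm; apply: cvgB.
Qed.

Lemma compact_positive (T : topologicalType) (K : set T) (f : T -> R) :
  compact K -> continuous f -> (forall x, K x -> 0 < f x) ->
  exists2 d, 0 < d & forall x, K x -> d <= f x.
Proof.
move=> cK cf f0; have [->|/set0P K0] := eqVneq K set0; first by exists 1.
have [c cin cmin] := compact_EVT_min K0 cK (continuous_subspaceT cf).
by exists (f c) => [|x Kx]; [apply: f0; exact: set_mem | apply: cmin; exact: mem_set].
Qed.

Lemma square_compact : compact (`[0, 1]%classic `*` `[0, 1]%classic : set (R * R)).
Proof. by apply: compact_setX; exact: segment_compact. Qed.

(* The maximum of [`|s - t|] and [e - pdist (g s) (g t)] is positive on the whole unit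
   square, hence bounded below; the same device separates two curves. *)
Lemma curve_uniform g e : continuous g -> 0 < e ->
  exists2 d, 0 < d & forall s t, 0 <= s <= 1 -> 0 <= t <= 1 -> `|s - t| < d -> pdist (g s) (g t) < e.
Proof.
move=> cg e0; have cg1 : continuous (fun x : R * R => g x.1).
  by move=> x; apply: (cvg_comp fst g); [exact: cvg_fst | exact: cg].
have cg2 : continuous (fun x : R * R => g x.2).
  by move=> x; apply: (cvg_comp snd g); [exact: cvg_snd | exact: cg].
pose F (x : R * R) := Num.max `|x.1 - x.2| (e - pdist (g x.1) (g x.2)).
have [|x _|d d0 dF] := compact_positive (f := F) square_compact.
- move=> x; apply: cvg_max.
    by apply: cvg_norm; apply: cvgB; [exact: cvg_fst | exact: cvg_snd].
  by apply: cvgB; [exact: cst_continuous | exact: (pdist_continuous cg1 cg2)].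
- rewrite /F lt_max normr_gt0 subr_eq0; case: eqP => //= ->.
  by rewrite /pdist !subrr normr0 maxxx subr0.
exists d => // s t s01 t01 lt_d; have := dF (s, t); rewrite /setX /= !in_itv /= s01 t01 => /(_ (conj isT isT)).
by rewrite /F /= le_max leNgt lt_d /= => le_d; rewrite -subr_gt0 (lt_le_trans d0).
Qed.

Lemma curves_separated g k p q r : continuous g -> continuous k -> 0 < r ->
  (forall s t, 0 <= s <= 1 -> 0 <= t <= 1 -> g s = k t -> g s = p \/ g s = q) ->
  exists2 d, 0 < d & forall s t, 0 <= s <= 1 -> 0 <= t <= 1 -> pdist (g s) (k t) < d ->
    pdist (g s) p < r \/ pdist (g s) q < r.
Proof.
move=> cg ck r0 meet; have cg1 : continuous (fun x : R * R => g x.1).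
  by move=> x; apply: (cvg_comp fst g); [exact: cvg_fst | exact: cg].
have ck2 : continuous (fun x : R * R => k x.2).
  by move=> x; apply: (cvg_comp snd k); [exact: cvg_snd | exact: ck].
pose F (x : R * R) := Num.max (pdist (g x.1) (k x.2))
  (Num.max (r - pdist (g x.1) p) (r - pdist (g x.1) q)).
have cst c : continuous (fun _ : R * R => c : plane R) by move=> x; exact: cst_continuous.
have [|[s t]|d d0 dF] := compact_positive (f := F) square_compact.
- move=> x; apply: cvg_max; first exact: (pdist_continuous cg1 ck2).
  by apply: cvg_max; apply: cvgB; try exact: cst_continuous; exact: pdist_continuous.
- rewrite /setX /= !in_itv /= => -[s01 t01]; rewrite /F lt_max pdist_gt0 lt_max /=; case: eqP => //= /(meet _ _ s01 t01)[] ->;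
    by rewrite /pdist !subrr normr0 maxxx subr0 r0 ?orbT.
exists d => // s t s01 t01 lt_d; have := dF (s, t); rewrite /setX /= !in_itv /= s01 t01 => /(_ (conj isT isT)).
rewrite /F /= le_max leNgt lt_d /= le_max => /orP[] le_d; [left|right];
  by rewrite -subr_gt0 (lt_le_trans d0).
Qed.

Lemma curve_avoids g p : continuous g -> (forall t, 0 <= t <= 1 -> g t <> p) ->
  exists2 d, 0 < d & forall t, 0 <= t <= 1 -> d <= pdist (g t) p.
Proof.
move=> cg gp; have [|t|d d0 dP] := compact_positive (f := fun t => pdist (g t) p) (@segment_compact R 0 1).
- by apply: pdist_continuous => // x; exact: cst_continuous.
- by rewrite in01 => /gp gtp; rewrite pdist_gt0; apply/eqP.
by exists d => // t t01; apply: dP; rewrite in01.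
Qed.

Lemma curve_bounded g : continuous g -> exists d, forall t, 0 <= t <= 1 -> pdist (g t) (0, 0) <= d.
Proof.
move=> cg; have c0 : {within `[0, 1], continuous (fun t => pdist (g t) (0, 0))}.
  apply: continuous_subspaceT; apply: pdist_continuous => // x; exact: cst_continuous.
have [c _ cmax] := EVT_max ler01 c0.
by exists (pdist (g c) (0, 0)) => t t01; apply: cmax; rewrite in_itv.
Qed.

Lemma fin_lower_bound (I : finType) (P : I -> R -> Prop) :
  (forall i, exists2 d, 0 < d & P i d) ->
  (forall i d d', 0 < d' -> d' <= d -> P i d -> P i d') ->
  exists2 d, 0 < d & forall i, P i d.
Proof.
move=> ex down; have /choice[f fP] : forall i, exists d, 0 < d /\ P i d.
  by move=> i; have [d] := ex i; exists d.
have gt0 : 0 < \big[Num.min/1]_i f i.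
  by elim/big_ind: _ => // [x y x0 y0|i _]; [rewrite lt_min x0 | case: (fP i)].
exists (\big[Num.min/1]_i f i) => // i; have [_] := fP i; apply: down => //.
exact: bigmin_le.
Qed.

End PlaneCurves.

(** * From a drawing with explicit scales to branch sets *)

Section Discretization.
Local Open Scope ring_scope.
Variables (R : realType) (T : finType) (edge : rel T).
Variables (pos : T -> plane R) (g : T -> T -> R -> plane R).
Variables (rho h C d : R).
Implicit Types (u v w : T) (p : plane R) (s t : R).
(** Blocks get radius [2 * rho] and tubes [2 * h]. Blocks are then disjoint by [4 * rho < 5 * rho],
    a tube misses foreign blocks by [2 * h + 2 * rho < 4 * rho], and tubes can meet only where their
    curves come within [4 * h]. *)
Hypotheses (h_gt0 : 0 < h) (h_small : 10 * h <= rho) (d_gt0 : 0 < d).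
Hypothesis pos_sep : forall u w, u != w -> 5 * rho <= pdist (pos u) (pos w).
Hypothesis g_far : forall u v w t, edge u v -> w != u -> w != v -> 0 <= t <= 1 ->
  4 * rho <= pdist (g u v t) (pos w).
(** Only curves with different tails have to stay apart: tubes with a common tail belong to the same
    branch set. *)
Hypothesis g_disj : forall u v u' v' s t, edge u v -> edge u' v' -> u != u' ->
  0 <= s <= 1 -> 0 <= t <= 1 -> pdist (g u v s) (g u' v' t) <= 4 * h ->
  pdist (g u v s) (pos u) < rho \/ pdist (g u v s) (pos v) < rho.
Hypothesis g_unif : forall u v s t, edge u v -> 0 <= s <= 1 -> 0 <= t <= 1 -> `|s - t| < d ->
  pdist (g u v s) (g u v t) <= h.
Hypothesis g0 : forall u v, edge u v -> g u v 0 = pos u.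
Hypothesis g1 : forall u v, edge u v -> g u v 1 = pos v.
Hypothesis pos_bound : forall u, pdist (pos u) (0, 0) <= C.
Hypothesis g_bound : forall u v t, edge u v -> 0 <= t <= 1 -> pdist (g u v t) (0, 0) <= C.

(** The grid of mesh [h] covers the square of half-width [C + 2 * rho] around the origin with spare
    steps at either end, so that all points in use are interior. *)
Let C' : R := C + 2 * rho + 2 * h.
Let N := (Num.truncn ((2 * C + 4 * rho) / h)).+4.+1.
Implicit Types (c q r : 'I_N * 'I_N).

Let rcoord (n : nat) : R := h * n%:R - C'.
Let discr (x : R) : nat := Num.truncn ((x + C') / h).
Let D p : 'I_N * 'I_N := (inord (discr p.1), inord (discr p.2)).
Let close q p (e : R) := (`|rcoord q.1 - p.1| <= e) && (`|rcoord q.2 - p.2| <= e).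

Let rcoord_le (m n : nat) : (m <= n)%N -> rcoord m <= rcoord n.
Proof. by move=> mn; rewrite lerD2r ler_pM2l // ler_nat. Qed.

Let N_big : 2 * C + 4 * rho + 4 * h < h * N%:R.
Proof.
have := real_truncnS_gt (num_real ((2 * C + 4 * rho) / h)).
rewrite ltr_pdivrMr // /N; set m := Num.truncn _.
by rewrite -[m.+4.+1]addn4 -[m.+1]addn1 !natrD; lra.
Qed.

Let rho_gt0 : 0 < rho.
Proof. by move: h_gt0 h_small; lra. Qed.

Let close_inner q p : pdist p (0, 0) <= C -> close q p (2 * rho) -> grid_interior q.
Proof.
have hh := h_gt0; have hr := h_small; have hrho := rho_gt0.
rewrite pdist_le /= !subr0 !ler_norml /close !ler_norml /rcoord /C'.
move=> /andP[/andP[a1 a2] /andP[a3 a4]] /andP[/andP[b1 b2] /andP[b3 b4]].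
have lo (n : nat) (x : R) : - C <= x -> - (2 * rho) <= h * n%:R - (C + 2 * rho + 2 * h) - x -> (0 < n)%N.
  by move=> xC; case: n => // ; rewrite mulr0; lra.
have hi (n : nat) (x : R) : x <= C -> h * n%:R - (C + 2 * rho + 2 * h) - x <= 2 * rho -> (n.+1 < N)%N.
  move=> xC hn; rewrite -(ltr_nat R) -(ltr_pM2l h_gt0) -addn1 natrD mulrDr mulr1.
  by have := N_big; lra.
by apply/and4P; split; [exact: lo b1 | exact: hi b2 | exact: lo b3 | exact: hi b4].
Qed.

Let close_D p : pdist p (0, 0) <= C -> close (D p) p h.
Proof.
have hh := h_gt0; have hr := h_small; have hrho := rho_gt0.
rewrite pdist_le /= !subr0 !ler_norml => /andP[/andP[a1 a2] /andP[a3 a4]].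
have coordD x : - C <= x -> x <= C -> `|rcoord (inord (discr x) : 'I_N) - x| <= h.
  move=> x1 x2; have x0 : 0 <= (x + C') / h by apply: divr_ge0; [rewrite /C'; lra | exact: ltW].
  have /andP[] := truncn_itv x0; rewrite -/(discr x) ler_pdivlMr // ltr_pdivrMr // => t1 t2.
  have lt_N : (discr x < N)%N.
    by rewrite -(ltr_nat R) -(ltr_pM2r h_gt0); have := N_big; rewrite /C' in t1; lra.
  rewrite inordK // ler_norml /rcoord; move: t2; rewrite -addn1 natrD; lra.
by rewrite /close /D /= !coordD.
Qed.

Let close_mono q p e e' : e <= e' -> close q p e -> close q p e'.
Proof. by move=> le_e /andP[/le_trans le1 /le_trans le2]; rewrite /close le1 ?le2. Qed.

Let close_shift q p p' e e' : close q p e -> pdist p p' <= e' -> close q p' (e + e').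
Proof.
rewrite pdist_le => /andP[c1 c2] /andP[d1 d2]; apply/andP; split.
  by rewrite (le_trans (ler_distD p.1 _ _)) // lerD.
by rewrite (le_trans (ler_distD p.2 _ _)) // lerD.
Qed.

Let close_dist q p p' e e' : close q p e -> close q p' e' -> pdist p p' <= e + e'.
Proof.
move=> /andP[c1 c2] /andP[d1 d2]; rewrite pdist_le; apply/andP; split.
  by rewrite (le_trans (ler_distD (rcoord q.1) _ _)) // lerD // distrC.
by rewrite (le_trans (ler_distD (rcoord q.2) _ _)) // lerD // distrC.
Qed.

Let close_between c q r p e : close c p e -> close q p e -> between c q r -> close r p e.
Proof.
have conv (k m n : nat) x : `|rcoord k - x| <= e -> `|rcoord m - x| <= e ->
    (minn k m <= n)%N -> (n <= maxn k m)%N -> `|rcoord n - x| <= e.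
  rewrite !ler_norml => /andP[k1 k2] /andP[m1 m2] /rcoord_le le1 /rcoord_le le2.
  by case: (leqP k m) le1 le2 => _; lra.
move=> /andP[c1 c2] /andP[q1 q2] /and4P[m1 m2 m3 m4].
by apply/andP; split; [exact: conv c1 q1 m1 m2 | exact: conv c2 q2 m3 m4].
Qed.

(* The branch set [cell u] is the block of [u] together with the parts of the tubes of
   its outgoing edges [uv] that can be reached from there without entering the block of [v]. *)
Let box u q := close q (pos u) (2 * rho).
Let tube u v q := `[< exists2 t, 0 <= t <= 1 & close q (g u v t) (2 * h) >].
Let reach u v q := box u q || (tube u v q && ~~ box v q).
Let center u := D (pos u).
Let comp u v q := connect (within_grid (reach u v)) (center u) q.
Let cell u q := box u q || [exists v, edge u v && comp u v q].
Let beta q := [pick u | cell u q].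

Let box_center u : box u (center u).
Proof.
have hh := h_gt0; have hr := h_small; have hrho := rho_gt0.
by apply: (close_mono (e := h)); [lra | exact: close_D].
Qed.

Let comp_reach u v q : comp u v q -> reach u v q.
Proof. by apply: connect_last; rewrite /reach box_center. Qed.

Let box_disj u w q : box u q -> box w q -> u = w.
Proof.
have hh := h_gt0; have hr := h_small; have hrho := rho_gt0.
move=> bu bw; apply/eqP; apply: contraT => /pos_sep; have := close_dist bu bw; lra.
Qed.

Let tube_box u v w q : edge u v -> tube u v q -> box w q -> w = u \/ w = v.
Proof.
have hh := h_gt0; have hr := h_small; have hrho := rho_gt0.
move=> euv /asboolP[t t01 qt] bw.
have [->|wu] := eqVneq w u; [by left | have [->|wv] := eqVneq w v; [by right | exfalso]].
by have := g_far euv wu wv t01; have := close_dist qt bw; lra.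
Qed.

Let tube_disj u v u' v' q : edge u v -> edge u' v' -> u != u' -> tube u v q -> tube u' v' q ->
  box u q \/ box v q.
Proof.
have hh := h_gt0; have hr := h_small; have hrho := rho_gt0.
move=> e1 e2 uu' /asboolP[s s01 qs] /asboolP[t t01 qt].
have le4 : pdist (g u v s) (g u' v' t) <= 4 * h by have := close_dist qs qt; lra.
by case: (g_disj e1 e2 uu' s01 t01 le4) => lt_rho; [left|right];
  apply: close_mono (close_shift qs (ltW lt_rho)); lra.
Qed.

(** A tube meets no blocks but those of its ends, and tubes with different tails meet only inside
    the end blocks of the first. A reachable part avoids the block of its head, so every overlap
    comes down to a block of the tail. *)
Let cell_uniq u w q : cell u q -> cell w q -> u = w.
Proof.
have box_comp u' w' v' : box u' q -> edge w' v' -> comp w' v' q -> u' = w'.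
  move=> bu ewv /comp_reach /orP[|/andP[tq nb]]; first exact: box_disj.
  by case: (tube_box ewv tq bu) => // uv; rewrite -uv bu in nb.
have [-> //|uw] := eqVneq u w.
case/orP=> [bu|/existsP[v /andP[euv cu]]] /orP[bw|/existsP[x /andP[ewx cw]]].
- exact: box_disj bw.
- exact: box_comp ewx cw.
- by apply/esym; exact: box_comp euv cu.
have /orP[bu|/andP[tu nv]] := comp_reach cu; first exact: box_comp ewx cw.
have /orP[bw|/andP[tw nx]] := comp_reach cw; first by apply/esym; exact: box_comp euv cu.
case: (tube_disj euv ewx uw tu tw) => [bu|bv]; first exact: box_comp ewx cw.
by rewrite bv in nv.
Qed.

Let betaP u q : (beta q == Some u) = cell u q.
Proof.
rewrite /beta; case: pickP => [w cw|none]; last by rewrite none.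
apply/eqP/idP => [[<-] //|cu]; congr Some; exact: cell_uniq cw cu.
Qed.

Let cell_inner u q : cell u q -> grid_interior q.
Proof.
have hh := h_gt0; have hr := h_small; have hrho := rho_gt0.
case/orP=> [|/existsP[x /andP[eux /comp_reach /orP[]]]].
- exact: close_inner.
- exact: close_inner.
case/andP=> /asboolP[t t01 qt] _; apply: (close_inner (p := g u x t)) => //.
  exact: g_bound.
by apply: close_mono qt; lra.
Qed.

Let connect_box_center u q (U : pred ('I_N * 'I_N)) : (forall r, box u r -> U r) ->
  box u q -> connect (within_grid U) (center u) q.
Proof.
move=> sub bq; apply: connect_box => r btw; apply: sub.
exact: close_between (box_center u) bq btw.
Qed.

Let connect_cell u q : cell u q -> connect (within_grid (cell u)) (center u) q.
Proof.
case/orP=> [bq|/existsP[v /andP[euv /connect_component]]].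
  by apply: connect_box_center => // r br; rewrite /cell br.
apply: within_grid_sub => r cr; rewrite /cell; apply/orP; right.
by apply/existsP; exists v; rewrite euv.
Qed.

(** The curve is sampled with spacing less than [d]. The grid point of the next sample is within [h]
    of it, hence within [2 * h] of the current one, so the rectangle between consecutive grid points
    stays in the tube; this fixes the tube radius. *)
Let connect_tube u v : edge u v -> connect (within_grid (tube u v)) (center u) (center v).
Proof.
have hh := h_gt0; have hr := h_small; have hrho := rho_gt0.
move=> euv; pose M := (Num.truncn d^-1).+1.
have M_gt0 : 0 < M%:R :> R by rewrite ltr0n.
have M_d : M%:R^-1 < d.
  by rewrite -[d]invrK ltf_pV2 ?posrE ?invr_gt0 // /M real_truncnS_gt ?num_real.
have in01 k : (k <= M)%N -> 0 <= (k%:R / M%:R : R) <= 1.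
  move=> kM; rewrite divr_ge0 ?ler0n //= ler_pdivrMr // mul1r ler_nat //.
have steps k : (k <= M)%N -> connect (within_grid (tube u v)) (center u) (D (g u v (k%:R / M%:R))).
  elim: k => [|k IHk] kM; first by rewrite mul0r g0 // connect0.
  apply: connect_trans (IHk (ltnW kM)) _; apply: connect_box => r btw.
  have k01 := in01 k (ltnW kM); have k1 := in01 k.+1 kM.
  apply/asboolP; exists (k%:R / M%:R) => //; apply: close_between btw.
    by apply: (close_mono (e := h)); [lra | apply: close_D; exact: g_bound].
  have le_h : pdist (g u v (k.+1%:R / M%:R)) (g u v (k%:R / M%:R)) <= h.
    by apply: g_unif => //; rewrite -mulrBl -natrB // subSnn mul1r ger0_norm.
  by apply: close_mono (close_shift (close_D (g_bound euv k1)) le_h); lra.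
have := steps M (leqnn M); rewrite divff ?gt_eqF // g1 //.
Qed.

(** The tube leads to [center v], which the reachable part misses. Where the tube first leaves that
    part, only membership in the block of [v] can have stopped it. *)
Let adjacent_cells u v : edge u v -> u != v ->
  exists c q, [/\ cell_adj c q, beta c = Some u & beta q = Some v].
Proof.
move=> euv uv; have nv : ~~ comp u v (center v).
  apply/negP => /comp_reach; rewrite /reach box_center andbF orbF => bv.
  by rewrite (box_disj bv (box_center v)) eqxx in uv.
have [c [q [/and3P[adj tc tq] cc ncq]]] := connect_exit (connect_tube euv) (connect0 _ _) nv.
exists c, q; split=> //; apply/eqP; rewrite betaP /cell.
  by apply/orP; right; apply/existsP; exists v; rewrite euv.
have [bq|nbq] := boolP (box v q); first by apply/orP; left.
case/negP: ncq; apply: (connect_trans cc (connect1 _)).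
by rewrite /within_grid adj (comp_reach cc) /reach tq nbq orbT.
Qed.

Lemma discretized_grid_minor : irreflexive edge ->
  grid_minor (fun u v => edge u v || edge v u).
Proof.
move=> edge_irr; have neq u v : edge u v -> u != v.
  by apply: contraTneq => ->; rewrite edge_irr.
exists N, beta; split=> [q|u p q bp bq|u v].
- case bq: (beta q) => [u|] // _; by apply: (@cell_inner u); rewrite -betaP bq.
- move/eqP: bp; move/eqP: bq; rewrite !betaP => /connect_cell cq /connect_cell cp.
  rewrite within_grid_sym in cp; have := connect_trans cp cq.
  by apply: connect_sub => r r' /and3P[adj cr cr']; apply: connect1; rewrite /branch adj !betaP cr.
case/orP=> [euv|evu]; first exact: adjacent_cells (neq _ _ euv).
have [p [q [adj bp bq]]] := adjacent_cells evu (neq _ _ evu).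
by exists q, p; rewrite cell_adjC.
Qed.

End Discretization.

Section Planar.
Local Open Scope ring_scope.
Variables (R : realType) (G : sgraph).

(** Orienting each edge once assigns its tube to the branch set of its tail, and makes edges with
    different tails different as sets of ends. *)
Let edge : rel G := fun u v => adj u v && (enum_rank u < enum_rank v)%N.

Let edge_irr : irreflexive edge.
Proof. by move=> u; rewrite /edge ltnn andbF. Qed.

Let adj_neq (u v : G) : adj u v -> u != v.
Proof. by apply: contraTneq => ->; rewrite adj_irrefl. Qed.

Let edge_sets (u v u' v' : G) : edge u v -> edge u' v' -> u != u' -> [set u; v]%SET != [set u'; v']%SET.
Proof.
move=> /andP[_ lt1] /andP[_ lt2] uu'; apply/eqP => E.
have : u \in [set u'; v']%SET by rewrite -E !finset.inE eqxx.
have : u' \in [set u; v]%SET by rewrite E !finset.inE eqxx.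
rewrite !finset.inE eq_sym (negPf uu') /= => /eqP u'v /eqP uv'.
by rewrite u'v -uv' ltnNge (ltnW lt1) in lt2.
Qed.

Let drawing_curve (pos : G -> plane R) arc (d : G * G) : plane_drawing pos arc ->
  exists g : R -> plane R, continuous g /\ (edge d.1 d.2 ->
    [/\ g 0 = pos d.1, g 1 = pos d.2 & forall t, 0 <= t <= 1 -> arc [set d.1; d.2]%SET (g t)]).
Proof.
case=> _ arcs _ _; have [/andP[/arcs[g [cg _ g0 g1 arcE]] _]|_] := boolP (edge d.1 d.2); last first.
  by exists (fun=> (0, 0)); split=> // x; exact: cst_continuous.
exists (g \o (@clamp R)); split=> [|_]; first exact: continuous_clamp.
split=> [||t t01]; rewrite /= ?clampE ?lexx ?ler01 //.
by rewrite arcE; exists t; rewrite // in01.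
Qed.

Lemma planar_grid_minor : planar R G -> grid_minor (@adj G).
Proof.
case=> pos [arc drawing]; have [pos_inj _ arc_vertex arc_meet] := drawing.
have /choice[gg ggP] : forall d, exists g : R -> plane R, continuous g /\ (edge d.1 d.2 ->
    [/\ g 0 = pos d.1, g 1 = pos d.2 & forall t, 0 <= t <= 1 -> arc [set d.1; d.2]%SET (g t)]).
  by move=> d; exact: drawing_curve drawing.
pose g u v := gg (u, v).
have cg u v : continuous (g u v) by have [] := ggP (u, v).
have gP u v : edge u v -> [/\ g u v 0 = pos u, g u v 1 = pos v &
    forall t, 0 <= t <= 1 -> arc [set u; v]%SET (g u v t)] by case: (ggP (u, v)).
have [r1 r1_gt0 r1P] : exists2 r : R, 0 < r &
    forall i : G * G, i.1 != i.2 -> 5 * r <= pdist (pos i.1) (pos i.2).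
  apply: fin_lower_bound => [i|i a b b0 ba H /H]; last by lra.
  have [->|ne] := eqVneq i.1 i.2; first by exists 1; rewrite ?eqxx.
  exists (pdist (pos i.1) (pos i.2) / 5); last by move=> _; lra.
  by rewrite divr_gt0 // pdist_gt0 (inj_eq pos_inj).
have [r2 r2_gt0 r2P] : exists2 r : R, 0 < r & forall i : G * G * G,
    edge i.1.1 i.1.2 -> i.2 != i.1.1 -> i.2 != i.1.2 ->
    forall t, 0 <= t <= 1 -> 4 * r <= pdist (g i.1.1 i.1.2 t) (pos i.2).
  apply: fin_lower_bound => [[[u v] w]|i a b b0 ba H e1 e2 e3 t t01] /=; last first.
    by have := H e1 e2 e3 t t01; lra.
  have [H|nH] := boolP [&& edge u v, w != u & w != v]; last first.
    by exists 1 => // e1 e2 e3; rewrite e1 e2 e3 in nH.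
  case/and3P: H => euv wu wv; have [_ _ inarc] := gP u v euv.
  have [t t01|a a0 aP] := curve_avoids (p := pos w) (cg u v).
    move=> gw; have : w \in [set u; v]%SET.
      by apply: arc_vertex; [case/andP: euv | rewrite -gw; exact: inarc].
    by rewrite !finset.inE (negPf wu) (negPf wv).
  exists (a / 4); first by rewrite divr_gt0.
  by move=> _ _ _ t /aP; lra.
pose rho := Num.min r1 r2.
have rho_gt0 : 0 < rho by rewrite lt_min r1_gt0.
have rho1 : rho <= r1 by rewrite ge_min lexx.
have rho2 : rho <= r2 by rewrite ge_min lexx orbT.
have [dl dl_gt0 dlP] : exists2 r : R, 0 < r & forall i : (G * G) * (G * G),
    edge i.1.1 i.1.2 -> edge i.2.1 i.2.2 -> i.1.1 != i.2.1 ->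
    forall s t, 0 <= s <= 1 -> 0 <= t <= 1 -> pdist (g i.1.1 i.1.2 s) (g i.2.1 i.2.2 t) < r ->
    pdist (g i.1.1 i.1.2 s) (pos i.1.1) < rho \/ pdist (g i.1.1 i.1.2 s) (pos i.1.2) < rho.
  apply: fin_lower_bound => [[[u v] [u' v']]|i a b b0 ba H e1 e2 e3 s t s01 t01 lt] /=; last first.
    by apply: (H e1 e2 e3 s t) => //; apply: lt_le_trans ba.
  have [H|nH] := boolP [&& edge u v, edge u' v' & u != u']; last first.
    by exists 1 => // e1 e2 e3; rewrite e1 e2 e3 in nH.
  case/and3P: H => euv euv' uu'; have [_ _ in1] := gP u v euv; have [_ _ in2] := gP u' v' euv'.
  have [s t s01 t01 meet|a a0 aP] := curves_separated (p := pos u) (q := pos v) (cg u v) (cg u' v') rho_gt0.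
    have [a1 a2] : adj u v /\ adj u' v' by case/andP: euv; case/andP: euv'.
    have [|w [wuv ->]] := arc_meet u v u' v' a1 a2 (edge_sets euv euv' uu') (g u v s) (in1 s s01).
      by rewrite meet; exact: in2.
    by move: wuv; rewrite !finset.inE => /andP[/orP[]/eqP-> _]; [left | right].
  by exists a => // _ _ _ s t; exact: aP.
(* The second bound gives [4 * h < dl], so that meeting tubes bring their curves within the
   separation distance [dl]. *)
pose h := Num.min (rho / 10) (dl / 5).
have h_gt0 : 0 < h by rewrite lt_min !divr_gt0.
have h1 : h <= rho / 10 by rewrite ge_min lexx.
have h2 : h <= dl / 5 by rewrite ge_min lexx orbT.
have [d d_gt0 dP] : exists2 r : R, 0 < r & forall i : G * G, forall s t, 0 <= s <= 1 -> 0 <= t <= 1 ->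
    `|s - t| < r -> pdist (g i.1 i.2 s) (g i.1 i.2 t) <= h.
  apply: fin_lower_bound => [[u v]|i a b b0 ba H s t s01 t01 lt] /=; last first.
    by apply: H => //; apply: lt_le_trans ba.
  have [a a0 aP] := curve_uniform (cg u v) h_gt0.
  by exists a => // s t s01 t01 /(aP s t s01 t01)/ltW.
have /choice[bd bdP] : forall i : G * G, exists b : R, forall t, 0 <= t <= 1 -> pdist (g i.1 i.2 t) (0, 0) <= b.
  by move=> i; exact: curve_bounded.
pose C : R := \sum_i `|bd i| + \sum_u pdist (pos u) (0, 0).
have sum_ge (I : finType) (f : I -> R) i : (forall j, 0 <= f j) -> f i <= \sum_j f j.
  by move=> f0; rewrite (bigD1 i) //= lerDl sumr_ge0.
have C1 u : pdist (pos u) (0, 0) <= C.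
  rewrite (le_trans (sum_ge _ (fun u => pdist (pos u) (0, 0)) u _)) ?lerDr ?sumr_ge0 // => j.
  exact: pdist_ge0.
have C2 u v t : edge u v -> 0 <= t <= 1 -> pdist (g u v t) (0, 0) <= C.
  move=> _ t01; rewrite (le_trans (bdP (u, v) t t01)) // (le_trans (ler_norm _)) //.
  rewrite (le_trans (sum_ge _ (fun i => `|bd i|) (u, v) _)) ?lerDl ?sumr_ge0 // => j _.
  exact: pdist_ge0.
have gm : grid_minor (fun u v => edge u v || edge v u).
  apply: (@discretized_grid_minor R G edge pos g rho h C d) => //.
  - by lra.
  - by move=> u w uw; have := r1P (u, w) uw => /=; lra.
  - by move=> u v w t euv wu wv t01; have := r2P (u, v, w) euv wu wv t t01 => /=; lra.
  - move=> u v u' v' s t euv euv' uu' s01 t01 le4.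
    by apply: (dlP ((u, v), (u', v')) euv euv' uu' s t s01 t01); rewrite /=; lra.
  - by move=> u v s t _; exact: dP (u, v) s t.
  - by move=> u v /gP[].
  - by move=> u v /gP[].
apply: grid_minor_sub gm => u v uv; have := adj_neq uv.
rewrite /edge uv (adj_sym v) uv /=; case: ltngtP => // /val_inj/enum_rank_inj ->.
by rewrite eqxx.
Qed.

End Planar.

Theorem theorem1p3 (R : realType) (G : sgraph) (planarG : planar R G) :
  odd_chromatic_number G <= 9 /\
  exists phi : {ffun G -> 'I_9}, proper_coloring phi /\ odd_coloring phi.
Proof.
have [phi [proper_phi odd_phi]] :=
  grid_minor_colorable (@adj_sym G) (@adj_irrefl G) (planar_grid_minor planarG).
pose psi := [ffun x => phi x].
have proper_psi : proper_coloring psi.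
  by apply/forallP=> x; apply/forallP=> y; apply/implyP=> xy; rewrite !ffunE proper_phi.
have odd_psi : odd_coloring psi.
  apply/forallP=> x; apply/implyP=> /odd_phi /finset.set0Pn[c]; rewrite finset.inE => oddc.
  apply/existsP; exists c; rewrite (_ : finset _ = [set y in nb (@adj G) x | phi y == c]%SET) //.
  by apply/setP=> y; rewrite !finset.inE ffunE.
split; last by exists psi.
rewrite /odd_chromatic_number; case: ex_minnP => m _; apply.
by apply/existsP; exists psi; rewrite proper_psi.
Qed.
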